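(* Let $k_0\ge 2$ be an integer and let $E=(T_k)_{1\le k\le k_0}$ be a $k_0$-balanced set of webs, with associated webs $\mathcal{W}(n,E)$, $n\ge 2$. For $h\ge 0$ and $n\geq 2$ write $P_{h,n}:=P_h(\mathcal{W}(n,E))$. The following four assertions are equivalent: (i) the web $\mathcal{W}(n,E)$ is ordinary for every $n\ge 2$; (ii) the web $\mathcal{W}(k_0,E)$ is ordinary; (iii) the square matrix $P_{k_0,k_0}$ is invertible; (iv) for every $k$ with $1\le k\le k_0$, the square matrix $P_{k_0-k}(T_k)$, of size $c(k,k_0-k)\times c(k,k_0-k)$, is invertible.
   Context: Everything is holomorphic. For integers $n\ge 1$, $h\ge 0$, $c(n,h):=\binom{n+h-1}{h}$ is the dimension of the space of homogeneous polynomials of degree $h$ in $n$ variables. Webs. A $d$-web of codimension one on an open subset of $\mathbb{C}^n$ is given by $d$ holomorphic functions (first integrals) $u_1,\dots,u_d$ whose differentials are nonzero and pairwise linearly independent at each point (the foliations are $u_i=\mathrm{const}$). $k_0$-balanced sets. Fix $k_0\ge 2$. A $k_0$-balanced set of webs $E=(T_k)_{1\le k\le k_0}$ consists, for each $k=1,\dots,k_0$, of a $c(k,k_0-k)$-web $T_k$ on a nonempty connected open set $U_k\subset\mathbb{C}^k$, given by first integrals $u_b(x_1,\dots,x_k)$, $1\le b\le c(k,k_0-k)$ (in particular $T_1$ is given by a single function of one variable with nowhere zero derivative, e.g. $x\mapsto x$), such that: - each first integral $u_b$ of $T_k$ explicitly involves all the variables $x_1,\dots,x_k$, i.e. none of the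 partial derivatives $\partial u_b/\partial x_j$, $1\le j\le k$, vanishes identically on $U_k$; - for each $n\ge 2$, the superposition $\mathcal{W}(n,E)$ described next is a web on a nonempty open subset of $\mathbb{C}^n$. For a multi-index $I=(1\le i_1<\dots<i_k\le n)$ let $\pi_I^n:\mathbb{C}^n\to\mathbb{C}^k$, $(x_1,\dots,x_n)\mapsto(x_{i_1},\dots,x_{i_k})$. Then $\mathcal{W}(n,E)$ is the web whose first integrals are all the functions $u_b\circ\pi_I^n$, where $k$ runs over $1\le k\le \min(k_0,n)$, $I$ over all such multi-indices of length $k$, and $u_b$ over the first integrals of $T_k$. Its domain $D_n$ is the open set (assumed nonempty) of points $x\in\mathbb{C}^n$ such that $\pi_I^n(x)\in U_k$ for all these $k$ and $I$ and such that the differentials at $x$ of all these first integrals are pairwise linearly independent. The number of first integrals of $\mathcal{W}(n,E)$ is exactly $c(n,k_0)$. Matrices $P_h$ and ordinary webs. For a $d$-web $W$ in dimension $n$ with first integrals $u_1,\dots,u_d$ and an integer $h\ge 0$, $P_h(W)$ is the $c(n,h)\times d$ matrix of functions whose columns are indexed by $i\in\{1,\dots,d\}$, whose rows are indexed by the multi-indices $L=(\ell_1,\dots,\ell_n)$ of integers $\ell_\lambda\ge 0$ with $|L|=\ell_1+\dots+\ell_n=h$, and whose entries are $$c_L^i(W)=\prod_{\lambda=1}^n\Bigl(\frac{\partial u_i}{\partial x_\lambda}\Bigr)^{\ell_\lambda}.$$ The web $W$ is ordinary at a point if all the matrices $P_h(W)$, $h\ge 1$, have maximal rank $\min(d,c(n,h))$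 at (hence near) this point. Convention: statements about a web or a matrix of functions are understood at generic points, i.e. ''$W$ is ordinary'' means ordinary at every point of a dense open subset of its domain of definition, and a square matrix of functions is ''invertible'' if its determinant is nonzero at every point of a dense open subset of the domain ($D_{k_0}$ in (iii), $U_k$ in (iv)). *)

(* Defs.v *)
From HB Require Import structures.
From mathcomp Require Import all_boot all_order all_algebra.
From mathcomp Require Import all_classical all_reals all_analysis.
From mathcomp Require Import complex.

Set Implicit Arguments.
Unset Strict Implicit.
Unset Printing Implicit Defensive.

Import Order.TTheory GRing.Theory Num.Theory.
Import numFieldNormedType.Exports.

Local Open Scope classical_set_scope.
Local Open Scope ring_scope.

(* The field of complex numbers; stated as a numClosedFieldType so that it
   inherits the generic topology and norm of numeric fields, for which
   [differentiable], ['d] and ['D_v] are the complex (C-linear) notions. *)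
Definition Cplx (R : realType) : numClosedFieldType := R[i].

Definition c (n h : nat) : nat := 'C(n + h - 1, h).

Definition generically (T : topologicalType) (D : set T) (P : T -> Prop) :
    Prop :=
  exists O : set T, [/\ open O, O `<=` D, D `<=` closure O
                      & forall x, O x -> P x].

Lemma card_multi_index (n h : nat) :
  #|[set L : n.-tuple 'I_h.+1 | \sum_(l <- L) (l : nat) == h]%SET%N| = c n h.
Proof.
rewrite /c; case: n => [|n].
  case: h => [|h].
    transitivity #|{: 0.-tuple 'I_1}|; last by rewrite card_tuple.
    by apply: eq_card => t; rewrite tuple0 !inE big_nil.
  rewrite add0n subn1 bin_small //; apply: eq_card0 => t.
  by rewrite [t]tuple0 !inE big_nil.
by rewrite card_ord_partitions addSn subn1 /= -bin_sub ?leq_addr // addKn.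
Qed.

(* The multi-indices L = (l_1, ..., l_n) with |L| = h, in a fixed order. *)
Definition multi_index (n h : nat) (r : 'I_(c n h)) : n.-tuple 'I_h.+1 :=
  enum_val (cast_ord (esym (card_multi_index n h)) r).

(* The triples (k, I, u_b) indexing the first integrals of the superposition
   W(n, E).  Here [k : 'I_k0] stands for the dimension k + 1, so that k + 1 runs
   over 1, ..., k0; strictly increasing tuples only exist for k + 1 <= n. *)
Definition super_index (k0 n : nat) : finType :=
  {k : 'I_k0 & ({I : k.+1.-tuple 'I_n | sorted ltn (map val I)} *
                'I_(c k.+1 (k0 - k.+1)))%type}.

Lemma card_super_index (k0 n : nat) :
  (2 <= k0)%N -> #|super_index k0 n| = c n k0.
Proof.
case: k0 => // m _; rewrite card_tagged sumnE big_map big_enum /=.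
transitivity (\sum_(k < m.+2) 'C(n, k) * 'C(m, m.+1 - k))%N.
  rewrite big_ord_recl subn0 (@bin_small m m.+1) // muln0 add0n.
  apply: eq_bigr => k _; rewrite card_prod card_ord card_sig.
  congr (_ * _)%N; last first.
    by rewrite /c subnKC ?ltn_ord // subn1.
  by rewrite -card_ltn_sorted_tuples; apply: eq_card => t; rewrite !inE.
by rewrite binomial.Vandermonde /c addnS subn1.
Qed.

(* The data of E = (T_k), 1 <= k <= k0: T_k is given on [dom k] by the first
   integrals [fint k].  The components with k = 0 or k > k0 are never used. *)
Record web_family (R : realType) (k0 : nat) := WebFamily {
  dom : forall k : nat, set 'rV[Cplx R]_k;
  fint : forall k : nat, 'I_(c k (k0 - k)) -> 'rV[Cplx R]_k -> Cplx R
}.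

Arguments dom {R k0} w k.
Arguments fint {R k0} w k.

Section Webs.
Variable R : realType.
Local Notation C := (Cplx R).

Section OneWeb.
Variables n d : nat.
Implicit Types (D : set 'rV[C]_n) (u : 'I_d -> 'rV[C]_n -> C).

Definition holomorphic_on D (f : 'rV[C]_n -> C) : Prop :=
  forall x : 'rV[C]_n, D x -> differentiable f x.

Definition diff_indep (f g : 'rV[C]_n -> C) (x : 'rV[C]_n) : Prop :=
  forall a b : C, (forall v : 'rV[C]_n, a * 'd f x v + b * 'd g x v = 0) ->
  a = 0 /\ b = 0.

Definition is_web D u : Prop :=
  [/\ open D,
      forall i, holomorphic_on D (u i),
      forall i (x : 'rV[C]_n), D x -> exists v, 'd (u i) x v != 0
    & forall i j (x : 'rV[C]_n), i != j -> D x -> diff_indep (u i) (u j) x].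

Definition web_mx u (h : nat) (x : 'rV[C]_n) : 'M[C]_(c n h, d) :=
  \matrix_(r < c n h, i < d)
    \prod_(l < n) ('D_('e_l) (u i) x) ^+ tnth (multi_index r) l.

Definition ordinary_at u (x : 'rV[C]_n) : Prop :=
  forall h, (1 <= h)%N -> \rank (web_mx u h x) = minn d (c n h).

Definition ordinary D u : Prop := generically D (ordinary_at u).

Definition generically_invertible D (M : 'rV[C]_n -> 'M[C]_d) : Prop :=
  generically D (fun x => \det (M x) != 0).

End OneWeb.

Definition proj (n k : nat) (I : k.-tuple 'I_n) (x : 'rV[C]_n) : 'rV[C]_k :=
  \row_(j < k) x 0 (tnth I j).

Section Superposition.
Variables (k0 : nat) (E : web_family R k0) (n : nat).

Definition super_fint (s : super_index k0 n) (x : 'rV[C]_n) : C :=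
  fint E _ (tagged s).2 (proj (val (tagged s).1) x).

Definition super_dom : set 'rV[C]_n :=
  [set x | (forall k (I : k.-tuple 'I_n), (1 <= k <= k0)%N ->
              sorted ltn (map val I) -> dom E k (proj I x)) /\
           (forall s t : super_index k0 n, s != t ->
              diff_indep (super_fint s) (super_fint t) x)].

(* The first integrals of W(n, E), numbered from 0 to c(n, k0) - 1. *)
Definition super_web (hk0 : (2 <= k0)%N) (i : 'I_(c n k0)) : 'rV[C]_n -> C :=
  super_fint (enum_val (cast_ord (esym (card_super_index n hk0)) i)).

End Superposition.

End Webs.

Arguments super_dom {R k0} E n.
Arguments super_web {R k0} E n hk0 i.

Definition balanced (R : realType) (k0 : nat) (E : web_family R k0) : Prop :=
  (forall k, (1 <= k <= k0)%N ->
     [/\ dom E k !=set0, connected (dom E k), is_web (dom E k) (fint E k)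
       & forall (b : 'I_(c k (k0 - k))) (j : 'I_k),
           exists2 x : 'rV[Cplx R]_k, dom E k x & 'D_('e_j) (fint E k b) x != 0]) /\
  (forall n, (2 <= n)%N -> super_dom E n !=set0).

(* Main.v *)
(* Order the multi-indices of degree k0 by their supports.  The matrix P_{k0,n} is then
   block triangular: the row L vanishes on the columns (I, u_b) with I not containing the
   support of L, and the diagonal block at I, |I| = k, is P_{k0-k}(T_k) at pi_I(x), with
   the column of u_b multiplied by the product of all the partial derivatives of u_b.
   Hence P_{k0,n} is invertible at x as soon as all the P_{k0-k}(T_k) and all the partial
   derivatives are nonsingular at the pi_I(x), and conversely for n = k0.  If P_{k0,n} is
   invertible at x, then every P_{h,n} has maximal rank there: for h < k0 a relation
   between the rows is a form of degree h, and x_1^(k0-h) times it is a relation in degree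
   k0; for h > k0 a relation between the columns multiplied by (d_l u_i)^(h-k0) is a
   relation in degree k0.

   Passing from "nonzero somewhere" to "nonzero generically" on a connected domain is the
   identity theorem, applied to polynomials in the partial derivatives of the first
   integrals.  It, and the holomorphy of partial derivatives, follow from a Cauchy formula
   on the square [-1,1]^2 obtained from Goursat's bisection argument. *)

From HB Require Import structures.
Require Import Defs.
From mathcomp Require Import all_boot all_order all_algebra.
From mathcomp Require Import all_classical all_reals all_analysis.
From mathcomp Require Import complex ring lra.

Set Implicit Arguments.
Unset Strict Implicit.
Unset Printing Implicit Defensive.

Import Order.TTheory GRing.Theory Num.Theory.
Import numFieldNormedType.Exports.

Local Open Scope classical_set_scope.
Local Open Scope ring_scope.

(** * Complex-valued integrals on [-1, 1] *)

(** Holomorphic function theory is built here from real integrals of continuous functions. A contour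
    integral is an increment of a primitive whose real and imaginary parts are real primitives, and
    every estimate comes from the mean value theorem applied to both parts. Hence the polygonal
    contour, the crude constants such as 16 and 32, and a substitute for 2 pi i that is never
    evaluated.

    One complex variable suffices, because functions of several variables are studied along the
    lines [t *: v + y]: the estimates depend only on a bound for the function, so they are uniform
    in the base point.

    The domain of a superposition is cut out by independence conditions and is not assumed
    connected. The identity theorem is therefore applied only on the domains of the T_k, and
    genericity is pulled back to C^n along the coordinate projections. *)

Section Primitive.
Variable R : realType.
Notation mu := (@lebesgue_measure R).

(* The base point is any number below [-1], so that the derivative exists on [-1, 1]. *)
Definition prim (k : R -> R) (x : R) : R :=
  (\int[mu]_(t in `[(-2)%R, x]) k t)%R.

Lemma is_derive_prim (k : R -> R) (x : R) : continuous k ->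
  -1 <= x <= 1 -> is_derive x 1 (prim k) (k x).
Proof.
move=> kc /andP[x1 x2].
have ki : mu.-integrable `[(-2)%R, 2%R] (EFin \o k).
  apply: continuous_compact_integrable; first exact: segment_compact.
  exact: continuous_subspaceT.
have x3 : -2 < x by lra.
have x4 : x < 2 by lra.
have [|d e] := @continuous_FTC1 R k (BLeft (-2)) x 2 x4 ki _ (kc x).
  by rewrite lte_fin.
have dP : is_derive x 1 (prim k) ('D_1 (prim k) x) := derivableP d.
by rewrite -(e : ((prim k)^`())%classic x = k x) derive1E.
Qed.

Lemma primitive_bound (F f : R -> R) (a b M : R) :
  -1 <= a -> a <= b -> b <= 1 ->
  (forall x : R, -1 <= x <= 1 -> is_derive x 1 F (f x)) ->
  (forall x : R, a <= x <= b -> `|f x| <= M) ->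
  `|F b - F a| <= M * (b - a).
Proof.
move=> a1 ab b1 dF fM.
have [||c cab ->] := @MVT_segment R F f a b ab.
- by move=> x /[!in_itv] /andP[/ltW ax /ltW xb]; apply: dF; lra.
- apply: continuous_in_subspaceT => x; rewrite inE /= in_itv /= => /andP[ax xb].
  apply: differentiable_continuous; apply/derivable1_diffP.
  by have [|? _] := dF x; first lra.
rewrite normrM (ger0_norm (_ : 0 <= b - a)) ?subr_ge0 //.
by apply: ler_wpM2r; [rewrite subr_ge0 | apply: fM; move: cab; rewrite in_itv].
Qed.
End Primitive.

Section ComplexBasics.
Variable R : realType.
Local Notation C := (Cplx R).
Local Notation ReC := (@complex.Re R : C -> R).
Local Notation ImC := (@complex.Im R : C -> R).

Definition rC (x : R) : C := (x%:C)%C.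

Fact rC_zmod_morphism : zmod_morphism rC.
Proof. by move=> x y; apply: (rmorphB (real_complex R)). Qed.

Fact rC_monoid_morphism : monoid_morphism rC.
Proof. by split=> // x y; apply: (rmorphM (real_complex R)). Qed.

HB.instance Definition _ := GRing.isZmodMorphism.Build R C rC rC_zmod_morphism.
HB.instance Definition _ := GRing.isMonoidMorphism.Build R C rC rC_monoid_morphism.

Lemma rC_le (x y : R) : (rC x <= rC y) = (x <= y).
Proof. exact: lecR. Qed.

Lemma rC_lt (x y : R) : (rC x < rC y) = (x < y).
Proof. exact: ltcR. Qed.

Lemma complexE_rC (z : C) : z = rC (ReC z) + 'i * rC (ImC z).
Proof. by rewrite -complexiE; exact: complexE. Qed.

Lemma norm_i : `|'i : C| = 1.
Proof. exact: normCi. Qed.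

Lemma Re_le (z : C) : rC `|ReC z| <= `|z|.
Proof. exact: normc_ge_Re. Qed.

Lemma Im_le (z : C) : rC `|ImC z| <= `|z|.
Proof.
have := Re_le ((- 'i : C) * z); rewrite normrM normrN norm_i mul1r -complexiE.
by case: z => a b; rewrite /= !oppr0 mul0r mulN1r opprK add0r.
Qed.

Lemma norm_rC (x : R) : `|rC x| = rC `|x|.
Proof.
by rewrite {1}/rC; apply: etrans (normc_def _) _; rewrite /= expr0n /= addr0 sqrtr_sqr.
Qed.

Lemma norm_le_ReIm (z : C) : `|z| <= rC (`|ReC z| + `|ImC z|).
Proof.
rewrite {1}(complexE_rC z) rmorphD /= -!norm_rC; apply: (le_trans (ler_normD _ _)).
by rewrite normrM norm_i mul1r.
Qed.

(** The order of [C] is partial: being comparable with a norm forces a bound to be real. Bounds can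
    thus live in [C] and be transferred to the reals when needed. *)
Lemma ge_norm_rC (z M : C) : `|z| <= M -> M = rC (ReC M).
Proof.
move=> zM; apply/esym/RRe_real/ger0_real.
exact: le_trans zM.
Qed.

Definition ccont (k : R -> C) := continuous (ReC \o k) /\ continuous (ImC \o k).

Definition cderiv (F k : R -> C) := forall x : R, -1 <= x <= 1 ->
  is_derive x 1 (ReC \o F) (ReC (k x)) /\ is_derive x 1 (ImC \o F) (ImC (k x)).

Definition cprim (k : R -> C) (x : R) : C :=
  (prim (ReC \o k) x +i* prim (ImC \o k) x)%C.

Lemma cderiv_cprim (k : R -> C) : ccont k -> cderiv (cprim k) k.
Proof. by case=> rc ic x x1; split; exact: is_derive_prim. Qed.

Lemma ReD (z w : C) : ReC (z + w) = ReC z + ReC w.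
Proof. by case: z w => ? ? [? ?]. Qed.

Lemma ImD (z w : C) : ImC (z + w) = ImC z + ImC w.
Proof. by case: z w => ? ? [? ?]. Qed.

Lemma ReM (z w : C) : ReC (z * w) = ReC z * ReC w - ImC z * ImC w.
Proof. by case: z w => ? ? [? ?]. Qed.

Lemma ImM (z w : C) : ImC (z * w) = ReC z * ImC w + ImC z * ReC w.
Proof. by case: z w => ? ? [? ?]. Qed.

Lemma cderiv_lin (a : C) (F G k l : R -> C) : cderiv F k -> cderiv G l ->
  cderiv (fun x => a * F x + G x) (fun x => a * k x + l x).
Proof.
move=> dF dG x x1; have [F1 F2] := dF x x1; have [G1 G2] := dG x x1.
have -> : ReC \o (fun x => a * F x + G x) = (ReC a *: (ReC \o F)
     - ImC a *: (ImC \o F)) + (ReC \o G).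
  by apply/funext => t /=; rewrite ReD ReM.
have -> : ImC \o (fun x => a * F x + G x) = (ReC a *: (ImC \o F)
     + ImC a *: (ReC \o F)) + (ImC \o G).
  by apply/funext => t /=; rewrite ImD ImM.
rewrite ReD ReM ImD ImM; split.
  exact: is_deriveD (is_deriveB (is_deriveZ (ReC a) F1) (is_deriveZ (ImC a) F2)) G1.
exact: is_deriveD (is_deriveD (is_deriveZ (ReC a) F2) (is_deriveZ (ImC a) F1)) G2.
Qed.

(** The mean value theorem fails for complex values; applying it to the real and imaginary parts
    separately costs the factor 2. *)
Lemma cderiv_bound (F k : R -> C) (a b : R) (M : C) : cderiv F k ->
  -1 <= a -> a <= b -> b <= 1 ->
  (forall x : R, a <= x <= b -> `|k x| <= M) ->
  `|F b - F a| <= 2 * M * rC (b - a).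
Proof.
move=> dF a1 ab b1 kM.
have ME : M = rC (ReC M) by apply: (ge_norm_rC (kM a _)); rewrite lexx ab.
apply: le_trans (norm_le_ReIm _) _.
have -> : 2 * M * rC (b - a) = rC (ReC M * (b - a) + ReC M * (b - a)).
  by rewrite {1}ME; move: (b - a) => d; rewrite rmorphD !rmorphM; ring.
rewrite rC_le !raddfB; apply: lerD.
  apply: (@primitive_bound _ (ReC \o F) (ReC \o k)) => // x x1.
    by have [] := dF x x1.
  by rewrite -rC_le -ME; apply: le_trans (Re_le _) (kM _ x1).
apply: (@primitive_bound _ (ImC \o F) (ImC \o k)) => // x x1.
  by have [] := dF x x1.
by rewrite -rC_le -ME; apply: le_trans (Im_le _) (kM _ x1).
Qed.
End ComplexBasics.

(** * Cauchy's theorem and formula on a square *)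

Section Goursat.
Variable R : realType.
Local Notation C := (Cplx R).

(* For [P = 'i B - A], with [A] and [B] primitives of [f] in [x] and in [y], this is the
   integral of [f] along the boundary of the rectangle. *)
Definition ddiff (P : R -> R -> C) (x0 x1 y0 y1 : R) : C :=
  P x1 y1 - P x0 y1 - P x1 y0 + P x0 y0.

(** A mixed second difference is additive under subdivision, so the four quarters cannot all carry
    less than a quarter of the total modulus. The booleans tell which half is taken in each
    direction. *)
Lemma ddiff_quarter (P : R -> R -> C) (x h y k : R) :
  exists ij : bool * bool,
  `|ddiff P x (x + h) y (y + k)| <=
  4 * `|ddiff P (x + ij.1%:R * (h / 2)) (x + ij.1%:R * (h / 2) + h / 2)
                (y + ij.2%:R * (k / 2)) (y + ij.2%:R * (k / 2) + k / 2)|.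
Proof.
apply: contrapT => /forallNP N.
have {}N (i j : bool) : 4 * `|ddiff P (x + i%:R * (h / 2)) (x + i%:R * (h / 2) + h / 2)
                (y + j%:R * (k / 2)) (y + j%:R * (k / 2) + k / 2)|
   < `|ddiff P x (x + h) y (y + k)|.
  by rewrite real_ltNge ?normr_real ?rpredM ?normr_real ?realn //; apply/negP/(N (i, j)).
have := ltrD (ltrD (N false false) (N true false)) (ltrD (N false true) (N true true)).
rewrite /= !mul0r !mul1r !addr0 -!addrA -!splitr.
set a := ddiff P x _ y _; set b := ddiff P _ _ y _; set c := ddiff P x _ _ _.
set d := ddiff P _ _ (y + _) _; set e := ddiff P x (x + h) y (y + k).
have -> : e = a + b + (c + d) by rewrite /a /b /c /d /e /ddiff; ring.
move=> /lt_geF /negP; apply.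
have -> : 4 * `|a| + (4 * `|b| + (4 * `|c| + 4 * `|d|)) =
  4 * (`|a| + `|b| + (`|c| + `|d|)) by ring.
have -> (z : C) : z + (z + (z + z)) = 4 * z by ring.
rewrite ler_pM2l //; apply: le_trans (ler_normD _ _) _.
by apply: lerD; apply: ler_normD.
Qed.

Lemma nested_point (x l : nat -> R) :
  (forall n, x n <= x n.+1) -> (forall n, x n.+1 + l n.+1 <= x n + l n) ->
  (forall n, 0 <= l n) ->
  exists p, forall n, x n <= p <= x n + l n.
Proof.
move=> xS lS l0.
have xm n m : (n <= m)%N -> x n <= x m.
  by apply: (@homo_leq _ x <=%R) => //; exact: le_trans.
have lm n m : (n <= m)%N -> x m + l m <= x n + l n.
  move=> nm; rewrite -lerN2; move: nm.
  apply: (@homo_leq _ (fun n => - (x n + l n)) <=%R) => //; first exact: le_trans.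
  by move=> i; rewrite lerN2.
have xl n m : x n <= x m + l m.
  have /orP[nm|mn] := leq_total n m.
    by apply: le_trans (xm _ _ nm) _; rewrite lerDl.
  by apply: le_trans _ (lm _ _ mn); rewrite lerDl.
exists (sup (range x)) => n; apply/andP; split.
  apply: ub_le_sup; last by exists n.
  by exists (x 0%N + l 0%N) => _ [m _ <-].
by apply: ge_sup; [exists (x 0%N), 0%N | move=> _ [m _ <-]].
Qed.

(** Goursat's bisection for rectangles of a fixed shape: [t] is the scale, and the hypothesis says
    that the second difference is o(t^2) around each point. *)
Lemma ddiff_eq0 (P : R -> R -> C) (x0 y0 a b : R) : 0 <= a -> 0 <= b ->
  (forall p q, x0 <= p <= x0 + a -> y0 <= q <= y0 + b ->
    forall e : R, 0 < e -> exists2 d : R, 0 < d & forall x y t : R, 0 < t < d ->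
      x0 <= x -> x <= p -> p <= x + t * a -> x + t * a <= x0 + a ->
      y0 <= y -> y <= q -> q <= y + t * b -> y + t * b <= y0 + b ->
      `|ddiff P x (x + t * a) y (y + t * b)| <= rC (e * t ^+ 2)) ->
  ddiff P x0 (x0 + a) y0 (y0 + b) = 0.
Proof.
move=> a0 b0 loc.
have [c cP] := choice (fun s : R * R * R =>
  ddiff_quarter P s.1.1 (s.2 * a) s.1.2 (s.2 * b)).
(* The state is the lower left corner and the scale; the sides are the scale times [a] and [b]. *)
pose st := fix st n : R * R * R := if n is m.+1 then
  let s := st m in
  (s.1.1 + (c s).1%:R * (s.2 * a / 2), s.1.2 + (c s).2%:R * (s.2 * b / 2), s.2 / 2)
  else (x0, y0, 1).
have tE n : (st n).2 = 2^-1 ^+ n.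
  by elim: n => [|n IH]; rewrite ?expr0 // exprSr /= IH.
have t0 n : 0 < (st n).2 by rewrite tE exprn_gt0 // invr_gt0.
have key (z w : R) (i : bool) n : 0 <= z ->
  w <= w + i%:R * ((st n).2 * z / 2) /\
  w + i%:R * ((st n).2 * z / 2) + (st n).2 / 2 * z <= w + (st n).2 * z.
  move=> z0; have tz : 0 <= (st n).2 * z by rewrite mulr_ge0 // ltW.
  by case: i; rewrite /= ?mul0r ?mul1r; split; lra.
have [p pP] : exists p, forall n, (st n).1.1 <= p <= (st n).1.1 + (st n).2 * a.
  apply: nested_point => n; rewrite ?mulr_ge0 ?(ltW (t0 n)) //=.
    by have [] := key a (st n).1.1 (c (st n)).1 n a0.
  by have [] := key a (st n).1.1 (c (st n)).1 n a0.
have [q qP] : exists q, forall n, (st n).1.2 <= q <= (st n).1.2 + (st n).2 * b.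
  apply: nested_point => n; rewrite ?mulr_ge0 ?(ltW (t0 n)) //=.
    by have [] := key b (st n).1.2 (c (st n)).2 n b0.
  by have [] := key b (st n).1.2 (c (st n)).2 n b0.
have xb n : x0 <= (st n).1.1 /\ (st n).1.1 + (st n).2 * a <= x0 + a.
  elim: n => [|n [IH1 IH2]] /=; first by rewrite mul1r !lexx.
  by have [] := key a (st n).1.1 (c (st n)).1 n a0; lra.
have yb n : y0 <= (st n).1.2 /\ (st n).1.2 + (st n).2 * b <= y0 + b.
  elim: n => [|n [IH1 IH2]] /=; first by rewrite mul1r !lexx.
  by have [] := key b (st n).1.2 (c (st n)).2 n b0; lra.
pose D n : C := `|ddiff P (st n).1.1 ((st n).1.1 + (st n).2 * a)
   (st n).1.2 ((st n).1.2 + (st n).2 * b)|.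
have DS n : D n <= 4 * D n.+1.
  apply: le_trans (cP (st n)) _; rewrite /D /=.
  by rewrite (mulrAC _ _ a) (mulrAC _ _ b).
have Dn n : D 0%N <= 4 ^+ n * D n.
  elim: n => [|n IH]; first by rewrite expr0 mul1r.
  apply: le_trans IH _; rewrite exprSr -mulrA ler_wpM2l // exprn_ge0 //.
have Dx : D 0%N = `|ddiff P x0 (x0 + a) y0 (y0 + b)| by rewrite /D /= !mul1r.
apply/eqP; rewrite -normr_eq0 -Dx; apply/eqP.
have D0 : D 0%N = rC (complex.Re (D 0%N)).
  by apply: (@ge_norm_rC _ (ddiff P x0 (x0 + a) y0 (y0 + b))); rewrite Dx.
set e := complex.Re (D 0%N) in D0.
have : 0 <= e by rewrite -rC_le rmorph0 -D0 normr_ge0.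
rewrite D0 le_eqVlt => /orP[/eqP<-|e0]; first by rewrite rmorph0.
exfalso.
(* The local bound is used with half of the initial modulus [e]: after n bisections, e <= 4^n * (e /
   2) * (2^-n)^2 = e / 2. *)
have e2 : 0 < e / 2 by lra.
have [||d d0 dP] := loc p q _ _ _ e2.
- by have := pP 0%N; rewrite /= mul1r.
- by have := qP 0%N; rewrite /= mul1r.
have [n nd] : exists n, (st n).2 < d.
  have h : (2^-1 : R) ^+ n @[n --> \oo] --> (0 : R).
    by apply: cvg_expr; rewrite ger0_norm; lra.
  have [n _ /(_ n (leqnn n)) /=] := cvgr_lt _ h _ d0.
  by exists n; rewrite tE.
have := Dn n; rewrite D0.
have /andP[? ?] := pP n; have /andP[? ?] := qP n; have [? ?] := xb n; have [? ?] := yb n.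
have := dP (st n).1.1 (st n).1.2 (st n).2; rewrite t0 nd => /(_ isT) H.
have {}H : D n <= rC (e / 2 * (st n).2 ^+ 2) by apply: H.
move=> H2; have : rC e <= 4 ^+ n * rC (e / 2 * (st n).2 ^+ 2).
  by apply: le_trans H2 _; rewrite ler_wpM2l // exprn_ge0.
have -> : 4 ^+ n * rC (e / 2 * (st n).2 ^+ 2) = rC (e / 2).
  have -> : 4 ^+ n = rC (4 ^+ n) :> C.
    by rewrite (rmorphXn (@rC R)) rmorph_nat.
  rewrite -rmorphM tE -exprM mulnC exprM mulrCA -exprMn.
  by have -> : 4 * 2^-1 ^+ 2 = 1 :> R; [field | rewrite expr1n mulr1].
by rewrite rC_le; lra.
Qed.
End Goursat.

(** * Contour integrals along the boundary of the square [-1, 1]^2 *)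

Section Contour.
Variable R : realType.
Local Notation C := (Cplx R).
Local Notation ReC := (@complex.Re R : C -> R).
Local Notation ImC := (@complex.Im R : C -> R).
Local Notation rC := (@rC R).

Lemma gt0_rC (e : C) : 0 < e -> e = rC (ReC e) /\ 0 < ReC e.
Proof.
move=> e0; have eE : e = rC (ReC e) by apply: (@ge_norm_rC _ 0); rewrite normr0 ltW.
by split=> //; rewrite -rC_lt rmorph0 -eE.
Qed.

Lemma continuous_Re : continuous ReC.
Proof.
move=> z; apply/(@cvgrPdist_lt R R^o C (nbhs z)) => e e0.
apply/nbhs_ballP; exists (rC e); first by rewrite /= -(rmorph0 rC) rC_lt.
move=> w; rewrite -ball_normE /= -raddfB -rC_lt; exact: le_lt_trans (Re_le _).
Qed.

Lemma continuous_Im : continuous ImC.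
Proof.
move=> z; apply/(@cvgrPdist_lt R R^o C (nbhs z)) => e e0.
apply/nbhs_ballP; exists (rC e); first by rewrite /= -(rmorph0 rC) rC_lt.
move=> w; rewrite -ball_normE /= -raddfB -rC_lt; exact: le_lt_trans (Im_le _).
Qed.

Lemma continuous_rC : continuous rC.
Proof.
move=> x; apply/(@cvgrPdist_lt C C R (nbhs x)) => e /gt0_rC[-> e0].
apply/nbhs_ballP; exists (ReC e) => // y; rewrite -ball_normE /=.
by rewrite -rmorphB norm_rC rC_lt.
Qed.

Definition pt (x y : R) : C := rC x + 'i * rC y.

Definition clamp (t : R) : R := Num.max (-1) (Num.min 1 t).

Lemma clamp_bound t : -1 <= clamp t <= 1.
Proof. by rewrite /clamp le_max lexx ge_max ge_min lexx andbT /=; lra. Qed.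

Lemma clampE t : -1 <= t <= 1 -> clamp t = t.
Proof. by move=> /andP[a b]; rewrite /clamp (min_idPr b) (max_idPr a). Qed.

Lemma continuous_clamp : continuous clamp.
Proof.
move=> t.
have minc : {for t, continuous ((fun=> 1 : R^o) \min (fun s : R => s : R^o))}.
  by apply: continuous_min; [exact: cst_continuous | exact: cvg_id].
by apply: (continuous_max _ minc); exact: cst_continuous.
Qed.

Lemma cvg_pt (T : topologicalType) (f g : T -> R) (t : T) :
  {for t, continuous f} -> {for t, continuous g} ->
  {for t, continuous (fun s => pt (f s) (g s))}.
Proof.
move=> fc gc; apply: cvgD; first exact: (continuous_comp fc (@continuous_rC _)).
apply: cvgM; first exact: cvg_cst.
exact: (continuous_comp gc (@continuous_rC _)).
Qed.

Lemma ccontP (k : R -> C) : continuous k -> ccont k.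
Proof.
by move=> kc; split=> x; apply: continuous_comp (kc x) _;
  [exact: continuous_Re | exact: continuous_Im].
Qed.

Lemma ptB x y x' y' : pt x y - pt x' y' = pt (x - x') (y - y').
Proof. by rewrite /pt !rmorphB; ring. Qed.

Lemma norm_pt_le x y : `|pt x y| <= rC (`|x| + `|y|).
Proof.
apply: le_trans (ler_normD _ _) _.
by rewrite normrM norm_i mul1r !norm_rC -rmorphD.
Qed.

Lemma pt_ReIm z : pt (ReC z) (ImC z) = z.
Proof. exact/esym/complexE_rC. Qed.

Lemma Re_pt x y : ReC (pt x y) = x.
Proof. by rewrite /pt ReD ReM -complexiE /= mul0r mulr0 subrr addr0. Qed.

Lemma Im_pt x y : ImC (pt x y) = y.
Proof. by rewrite /pt ImD ImM -complexiE /= mul0r mul1r !add0r. Qed.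

Lemma cderiv_cst (a : C) : cderiv (fun=> a) (fun=> 0).
Proof. by move=> x _; split; apply: is_derive_cst. Qed.

Lemma cderivD (F G k l : R -> C) : cderiv F k -> cderiv G l ->
  cderiv (fun x => F x + G x) (fun x => k x + l x).
Proof.
move=> dF dG; have := cderiv_lin 1 dF dG.
by under eq_fun do rewrite mul1r; under [X in cderiv _ X]eq_fun do rewrite mul1r.
Qed.

Lemma cderivZ (a : C) (F k : R -> C) : cderiv F k ->
  cderiv (fun x => a * F x) (fun x => a * k x).
Proof.
move=> dF; have := cderiv_lin a dF (cderiv_cst 0).
by under eq_fun do rewrite addr0; under [X in cderiv _ X]eq_fun do rewrite addr0.
Qed.

Lemma cderivB (F G k l : R -> C) : cderiv F k -> cderiv G l ->
  cderiv (fun x => F x - G x) (fun x => k x - l x).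
Proof.
move=> dF dG; have := cderivD dF (cderivZ (-1) dG).
by under eq_fun do rewrite mulN1r; under [X in cderiv _ X]eq_fun do rewrite mulN1r.
Qed.

Lemma cderiv_rC : cderiv rC (fun=> 1).
Proof. by move=> x _; split; [exact: is_derive_id | exact: is_derive_cst]. Qed.

Lemma cderiv_sqr : cderiv (fun x => rC x ^+ 2 / 2) rC.
Proof.
have E t : rC t ^+ 2 / 2 = rC (2^-1 * t ^+ 2).
  by rewrite (rmorphM rC) fmorphV rmorph_nat (rmorphXn rC) mulrC.
under eq_fun do rewrite E.
move=> x _; split; last exact: is_derive_cst.
have -> : ReC \o (fun x => rC (2^-1 * x ^+ 2)) = 2^-1 *: ((fun t : R => t) ^+ 2).
  by [].
by apply: is_derive_eq; rewrite /= /GRing.scale /= expr1; field.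
Qed.

(** The bound of [cderiv_bound] with M = 0. It allows a contour to be computed from any convenient
    primitive. *)
Lemma cderiv_uniq (F G k l : R -> C) (a b : R) : -1 <= a -> a <= b -> b <= 1 ->
  cderiv F k -> cderiv G l -> (forall t : R, -1 <= t <= 1 -> k t = l t) ->
  F b - F a = G b - G a.
Proof.
move=> a1 ab b1 dF dG kl; apply/eqP; rewrite -subr_eq0 -normr_le0.
have := cderiv_bound (cderivB dF dG) a1 ab b1 (M := 0) _.
rewrite mulr0 mul0r; have -> : F b - G b - (F a - G a) = F b - F a - (G b - G a) by ring.
by apply=> x /andP[ax xb]; rewrite kl ?subrr ?normr0 //; lra.
Qed.

Definition square (z : C) : Prop := exists2 t : R, -1 <= t <= 1 &
  [\/ z = pt t (-1), z = pt t 1, z = pt 1 t | z = pt (-1) t].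

(* The four sides are parametrized by the same [t]; clamping makes the integrand
   continuous on the whole line when [h] is only continuous on the square. *)
Definition side_sum (h : C -> C) (t : R) : C :=
  h (pt (clamp t) (-1)) - h (pt (clamp t) 1) +
  'i * (h (pt 1 (clamp t)) - h (pt (-1) (clamp t))).

Definition contour (h : C -> C) : C :=
  cprim (side_sum h) 1 - cprim (side_sum h) (-1).

Definition square_continuous (h : C -> C) :=
  forall z, square z -> {for z, continuous h}.

Lemma square1 t : -1 <= t <= 1 -> square (pt t (-1)).
Proof. by exists t => //; constructor 1. Qed.
Lemma square2 t : -1 <= t <= 1 -> square (pt t 1).
Proof. by exists t => //; constructor 2. Qed.
Lemma square3 t : -1 <= t <= 1 -> square (pt 1 t).
Proof. by exists t => //; constructor 3. Qed.
Lemma square4 t : -1 <= t <= 1 -> square (pt (-1) t).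
Proof. by exists t => //; constructor 4. Qed.

Lemma square_ge1 z : square z -> 1 <= `|z|.
Proof.
move=> [t _ zE]; have [h|h] : `|ReC z| = 1 \/ `|ImC z| = 1.
- by case: zE => ->; rewrite Re_pt Im_pt ?normrN normr1; auto.
- by apply: le_trans (Re_le z); rewrite h.
- by apply: le_trans (Im_le z); rewrite h.
Qed.

(** Origin of the radius 3: on the square the absolute values of the real and imaginary parts add up
    to at most 2, so this open disc contains the contour. *)
Lemma square_lt z : square z -> `|z| < 3.
Proof.
move=> [t t1 zE]; have [h k] : `|ReC z| <= 1 /\ `|ImC z| <= 1.
  by case: zE => ->; rewrite Re_pt Im_pt ?normrN ?normr1 ler_norml lexx.
apply: le_lt_trans (norm_le_ReIm z) _.
by rewrite -(rmorph_nat rC 3) rC_lt; lra.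
Qed.

Lemma side_sum_ccont h : square_continuous h -> ccont (side_sum h).
Proof.
move=> hc; apply: ccontP => t.
have cc := clamp_bound t.
have kc (a : R) : {for t, continuous (fun=> a : R)} by exact: cst_continuous.
apply: cvgD; first apply: cvgB.
- exact: continuous_comp (cvg_pt (@continuous_clamp t) (kc (-1))) (hc _ (square1 cc)).
- exact: continuous_comp (cvg_pt (@continuous_clamp t) (kc 1)) (hc _ (square2 cc)).
apply: cvgM; first exact: cvg_cst.
apply: cvgB.
- exact: continuous_comp (cvg_pt (kc 1) (@continuous_clamp t)) (hc _ (square3 cc)).
- exact: continuous_comp (cvg_pt (kc (-1)) (@continuous_clamp t)) (hc _ (square4 cc)).
Qed.

Lemma le_N11 : -1 <= 1 :> R. Proof. by lra. Qed.

Lemma contour_primitive h (F : R -> C) : square_continuous h ->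
  cderiv F (side_sum h) -> contour h = F 1 - F (-1).
Proof.
move=> hc dF.
by apply: cderiv_uniq (cderiv_cprim (side_sum_ccont hc)) dF _; rewrite ?le_N11.
Qed.

Lemma contour_lin (a : C) h k : square_continuous h -> square_continuous k ->
  contour (fun z => a * h z + k z) = a * contour h + contour k.
Proof.
move=> hc kc.
have hkc : square_continuous (fun z => a * h z + k z).
  by move=> z zs; apply: cvgD (kc z zs); apply: cvgM (hc z zs); apply: cvg_cst.
rewrite (contour_primitive hkc (F := fun t => a * cprim (side_sum h) t + cprim (side_sum k) t)).
  by rewrite /contour; ring.
have -> : side_sum (fun z => a * h z + k z) = fun t => a * side_sum h t + side_sum k t.
  by apply/funext => t; rewrite /side_sum; ring.
by apply: cderiv_lin; apply: cderiv_cprim; apply: side_sum_ccont.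
Qed.

(** The constant is four sides, times the length 2, times the factor 2 of [cderiv_bound]. *)
Lemma contour_bound h (M : C) : square_continuous h ->
  (forall z, square z -> `|h z| <= M) -> `|contour h| <= 16 * M.
Proof.
move=> hc hM; rewrite /contour.
have -> : 16 * M = 2 * (4 * M) * rC (1 - (-1)).
  by rewrite opprK rmorphD rmorph1; ring.
apply: (cderiv_bound (cderiv_cprim (side_sum_ccont hc))); rewrite ?le_N11 //.
move=> t t1; rewrite /side_sum clampE //.
have -> : 4 * M = M + M + (M + M) by ring.
apply: le_trans (ler_normD _ _) (lerD _ _).
  apply: le_trans (ler_normB _ _) (lerD _ _); apply: hM; [exact: square1|exact: square2].
rewrite normrM norm_i mul1r.
apply: le_trans (ler_normB _ _) (lerD _ _); apply: hM; [exact: square3|exact: square4].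
Qed.

Lemma eq_contour h k : square_continuous h -> square_continuous k ->
  (forall z, square z -> h z = k z) -> contour h = contour k.
Proof.
move=> hc kc hk; apply: cderiv_uniq (cderiv_cprim (side_sum_ccont hc))
  (cderiv_cprim (side_sum_ccont kc)) _; rewrite ?le_N11 //.
move=> t t1; rewrite /side_sum clampE // !hk //;
  [exact: square4|exact: square3|exact: square2|exact: square1].
Qed.
End Contour.

(** * Goursat's theorem with one exceptional point *)

Section Cauchy.
Variable R : realType.
Local Notation C := (Cplx R).
Local Notation ReC := (@complex.Re R : C -> R).
Local Notation ImC := (@complex.Im R : C -> R).
Local Notation rC := (@rC R).

(** Clearing the denominator of the difference quotient removes the exception w = z and yields the
    affine approximation required by [ddiff_boundary]. *)
Lemma derivable_local (g : C -> C) (z : C) : derivable g z 1 ->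
  exists c : C, forall e : R, 0 < e -> exists2 d : R, 0 < d &
    forall w : C, `|w - z| < rC d -> `|g w - g z - c * (w - z)| <= rC e * `|w - z|.
Proof.
move=> /cvg_ex[c /= gc]; exists c => e e0.
have e0' : 0 < rC e by rewrite -(rmorph0 rC) rC_lt.
have /nbhs_ballP[d /gt0_rC[-> d0] dP] :
    nbhs (0^' : set_system C) (fun h => `|c - h^-1 *: (g (h *: 1 + z) - g z)| < rC e).
  exact: (@cvgrPdist_lt C C C _ _ _ c).1 gc _ e0'.
exists (ReC d) => // w wz.
have [->|wz0] := eqVneq w z; first by rewrite !subrr mulr0 subrr !normr0 mulr0.
have wz0' : w - z != 0 by rewrite subr_eq0.
have /= := dP (w - z); rewrite -ball_normE /= sub0r normrN => /(_ wz wz0').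
rewrite [_%:A]mulr1 subrK => /ltW H.
have -> : g w - g z - c * (w - z) = - ((c - (w - z)^-1 * (g w - g z)) * (w - z)).
  by field.
by rewrite normrN normrM ler_wpM2r.
Qed.

Lemma continuous_dist (V : normedModType C) (f : V -> C) (z : V) :
  {for z, continuous f} <-> (forall e : C, 0 < e ->
    exists2 d : R, 0 < d & forall w, `|w - z| < rC d -> `|f w - f z| < e).
Proof.
split=> [fc e e0|H].
  have /nbhs_ballP[d /gt0_rC[-> d0] dP] : nbhs z (fun w => `|f z - f w| < e).
    exact: (@cvgrPdist_lt C C V _ _ _ (f z)).1 fc _ e0.
  by exists (ReC d) => // w wz; rewrite distrC; apply: dP; rewrite -ball_normE /= distrC.
apply/(@cvgrPdist_lt C C V (nbhs z)) => e /H[d d0 dP].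
apply/nbhs_ballP; exists (rC d); first by rewrite /= -(rmorph0 rC) rC_lt.
by move=> w; rewrite -ball_normE /= distrC => /dP; rewrite distrC.
Qed.

Section Rectangle.
Variable g : C -> C.
Hypothesis gc : forall z : C, `|z| < 3 -> {for z, continuous g}.

Definition clamped (x y : R) : C := g (pt (clamp x) (clamp y)).

Lemma norm_pt_clamp (x y : R) : `|pt (clamp x) (clamp y)| < 3.
Proof.
apply: le_lt_trans (norm_pt_le _ _) _; rewrite -(rmorph_nat rC 3) rC_lt.
have hx : `|clamp x| <= 1 by rewrite ler_norml clamp_bound.
have hy : `|clamp y| <= 1 by rewrite ler_norml clamp_bound.
lra.
Qed.

Lemma clamped_ccontl (y : R) : ccont (clamped ^~ y).
Proof.
apply: ccontP => t; apply: (@continuous_comp _ _ _ (fun t => pt (clamp t) (clamp y)) g).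
  by apply: cvg_pt; [exact: continuous_clamp | exact: cst_continuous].
exact/gc/norm_pt_clamp.
Qed.

Lemma clamped_ccontr (x : R) : ccont (clamped x).
Proof.
apply: ccontP => t; apply: (@continuous_comp _ _ _ (fun t => pt (clamp x) (clamp t)) g).
  by apply: cvg_pt; [exact: cst_continuous | exact: continuous_clamp].
exact/gc/norm_pt_clamp.
Qed.

Definition boundary_primitive (x y : R) : C :=
  'i * cprim (clamped x) y - cprim (clamped ^~ y) x.

Lemma contour_ddiff : contour g = ddiff boundary_primitive (-1) 1 (-1) 1.
Proof.
have gs : square_continuous g by move=> z /square_lt; exact: gc.
rewrite (contour_primitive gs (F := fun t => cprim (clamped ^~ (-1)) t - cprim (clamped ^~ 1) t
   + 'i * (cprim (clamped 1) t - cprim (clamped (-1)) t))).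
  rewrite /ddiff /boundary_primitive.
  move: (cprim (clamped ^~ (-1))) (cprim (clamped ^~ 1)).
  by move: (cprim (clamped (-1))) (cprim (clamped 1)) => *; ring.
have -> : side_sum g = fun t => clamped t (-1) - clamped t 1 + 'i * (clamped 1 t - clamped (-1) t).
  have c1 : clamp 1 = 1 :> R by rewrite clampE // lexx le_N11.
  have cN1 : clamp (-1) = -1 :> R by rewrite clampE // lexx le_N11.
  by apply/funext => t; rewrite /side_sum /clamped c1 cN1.
apply: cderivD; first by apply: cderivB; apply: cderiv_cprim; apply: clamped_ccontl.
by apply: cderivZ; apply: cderivB; apply: cderiv_cprim; apply: clamped_ccontr.
Qed.

(** The boundary integral of an affine function is zero, so only the remainder counts; each side
    contributes at most [2 * M] times its length. *)
Lemma ddiff_boundary (f0 c p q : C) (A B : R) (M : C) (x0 x1 y0 y1 : R) :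
  -1 <= x0 -> x0 <= x1 -> x1 <= 1 -> -1 <= y0 -> y0 <= y1 -> y1 <= 1 ->
  x1 - x0 = A -> y1 - y0 = B ->
  (forall x y : R, x0 <= x <= x1 -> y0 <= y <= y1 ->
    `|g (pt x y) - f0 - c * (pt x y - (p + 'i * q))| <= M) ->
  `|ddiff boundary_primitive x0 x1 y0 y1| <= 4 * M * rC (A + B).
Proof.
move=> hx0 hx hx1 hy0 hy hy1 <- <- gM.
(* [pA] and [pB] are primitives of the affine part along horizontals and verticals; the second
   difference of 'i pB - pA vanishes identically. *)
pose pA y x : C := (f0 - c * p + c * 'i * (rC y - q)) * rC x + c * (rC x ^+ 2 / 2).
pose pB x y : C := (f0 - c * 'i * q + c * (rC x - p)) * rC y + c * 'i * (rC y ^+ 2 / 2).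
pose eA y x := cprim (clamped ^~ y) x - pA y x.
pose eB x y := cprim (clamped x) y - pB x y.
have dA y : cderiv (eA y) (fun x =>
    clamped x y - (f0 - c * p + c * 'i * (rC y - q) * 1 + c * rC x)).
  apply: cderivB; first exact/cderiv_cprim/clamped_ccontl.
  have := cderivD (cderivZ (f0 - c * p + c * 'i * (rC y - q)) (@cderiv_rC R))
     (cderivZ c (@cderiv_sqr R)).
  by rewrite !mulr1.
have dB x : cderiv (eB x) (fun y =>
    clamped x y - (f0 - c * 'i * q + c * (rC x - p) * 1 + c * 'i * rC y)).
  apply: cderivB; first exact/cderiv_cprim/clamped_ccontr.
  have := cderivD (cderivZ (f0 - c * 'i * q + c * (rC x - p)) (@cderiv_rC R))
     (cderivZ (c * 'i) (@cderiv_sqr R)).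
  by rewrite !mulr1.
have bA y : y0 <= y <= y1 -> `|eA y x1 - eA y x0| <= 2 * M * rC (x1 - x0).
  move=> yy; apply: (cderiv_bound (dA y)) => // x xx.
  have -> : clamped x y = g (pt x y) by rewrite /clamped !clampE //; lra.
  apply: le_trans (gM x y xx yy); rewrite le_eqVlt; apply/orP; left; apply/eqP.
  by congr `|_|; rewrite /pt; ring.
have bB x : x0 <= x <= x1 -> `|eB x y1 - eB x y0| <= 2 * M * rC (y1 - y0).
  move=> xx; apply: (cderiv_bound (dB x)) => // y yy.
  have -> : clamped x y = g (pt x y) by rewrite /clamped !clampE //; lra.
  apply: le_trans (gM x y xx yy); rewrite le_eqVlt; apply/orP; left; apply/eqP.
  by congr `|_|; rewrite /pt; ring.
have -> : ddiff boundary_primitive x0 x1 y0 y1 = ('i * (eB x1 y1 - eB x1 y0)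
    - 'i * (eB x0 y1 - eB x0 y0)) - ((eA y1 x1 - eA y1 x0) - (eA y0 x1 - eA y0 x0)).
  rewrite /ddiff /boundary_primitive /eA /eB.
  move: (cprim (clamped ^~ y0)) (cprim (clamped ^~ y1)).
  move: (cprim (clamped x0)) (cprim (clamped x1)) => *.
  by rewrite /pA /pB; ring.
have -> : 4 * M * rC (x1 - x0 + (y1 - y0)) = (2 * M * rC (y1 - y0) + 2 * M * rC (y1 - y0)) +
   (2 * M * rC (x1 - x0) + 2 * M * rC (x1 - x0)).
  by rewrite (rmorphD rC); ring.
apply: le_trans (ler_normB _ _) (lerD _ _).
  apply: le_trans (ler_normB _ _) (lerD _ _); rewrite normrM norm_i mul1r; apply: bB.
    by rewrite lexx hx.
  by rewrite lexx hx.
apply: le_trans (ler_normB _ _) (lerD _ _); apply: bA; by rewrite lexx hy.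
Qed.

Variable z0 : C.
Hypothesis gd : forall z : C, `|z| < 3 -> z != z0 -> derivable g z 1.

Lemma ddiff_boundary_eq0 (x0 x1 y0 y1 : R) :
  -1 <= x0 -> x0 <= x1 -> x1 <= 1 -> -1 <= y0 -> y0 <= y1 -> y1 <= 1 ->
  (forall x y : R, x0 <= x <= x1 -> y0 <= y <= y1 -> pt x y != z0) ->
  ddiff boundary_primitive x0 x1 y0 y1 = 0.
Proof.
move=> hx0 hx hx1 hy0 hy hy1 hz.
have -> : x1 = x0 + (x1 - x0) by ring.
have -> : y1 = y0 + (y1 - y0) by ring.
set a := x1 - x0; set b := y1 - y0.
have a0 : 0 <= a by rewrite /a; lra.
have b0 : 0 <= b by rewrite /b; lra.
apply: ddiff_eq0 => // p q pP qP e e0.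
have pq3 : `|pt p q| < 3.
  by rewrite -(@clampE _ p) -1?(@clampE _ q) ?norm_pt_clamp //; rewrite /a /b in pP qP; lra.
have [|c cP] := derivable_local (gd pq3 _); first by apply: hz; rewrite /a /b in pP qP; lra.
have K0 : 0 < (a + b) ^+ 2 + 1 by rewrite ltr_wpDl // sqr_ge0.
(* With this precision E the final estimate is 4 E (a + b)^2 t^2 <= e t^2. Adding 1 keeps the
   divisor positive when the rectangle is a point. *)
have [|d d0 dP] := cP (e / (4 * ((a + b) ^+ 2 + 1))).
  by rewrite divr_gt0 // mulr_gt0.
have ab1 : 0 < a + b + 1 by lra.
exists (d / (a + b + 1)); first by rewrite divr_gt0.
move=> x y t /andP[t0 td] x0x xp px xx1 y0y yq qy yy1.
have ta0 : 0 <= t * a by rewrite mulr_ge0 // ltW.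
have tb0 : 0 <= t * b by rewrite mulr_ge0 // ltW.
have tab : t * (a + b) < d.
  apply: (@le_lt_trans _ _ (t * (a + b + 1))); first by rewrite ler_pM2l // lerDl.
  by rewrite -ltr_pdivlMr.
set E := e / (4 * ((a + b) ^+ 2 + 1)) in dP *.
have E0 : 0 < E by rewrite divr_gt0 // mulr_gt0.
have := @ddiff_boundary (g (pt p q)) c (rC p) (rC q) (t * a) (t * b)
  (rC (E * (t * (a + b)))) x (x + t * a) y (y + t * b).
have -> : -1 <= x by apply: le_trans x0x.
have -> : x <= x + t * a by rewrite lerDl.
have -> : x + t * a <= 1 by apply: le_trans xx1 _; rewrite addrC subrK.
have -> : -1 <= y by apply: le_trans y0y.
have -> : y <= y + t * b by rewrite lerDl.
have -> : y + t * b <= 1 by apply: le_trans yy1 _; rewrite addrC subrK.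
move=> /(_ isT isT isT isT isT isT) H.
apply: le_trans (H _ _ _) _.
- by ring.
- by ring.
- move=> u v uu vv.
  have uvb : `|pt u v - pt p q| <= rC (t * (a + b)).
    rewrite ptB; apply: le_trans (norm_pt_le _ _) _; rewrite rC_le mulrDr.
    by apply: lerD; rewrite ler_norml; lra.
  apply: le_trans (dP _ _) _; first by apply: le_lt_trans uvb _; rewrite rC_lt.
  rewrite (rmorphM rC E); apply: ler_wpM2l => //.
  by rewrite -(rmorph0 rC) rC_le ltW.
- have -> : 4 * rC (E * (t * (a + b))) * rC (t * a + t * b) =
      rC (4 * (E * (t * (a + b))) * (t * a + t * b)).
    rewrite {E0 dP H}; move: E (a + b) (t * a + t * b) => E u v.
    by rewrite !(rmorphM rC) rmorph_nat.
  rewrite rC_le.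
  have -> : 4 * (E * (t * (a + b))) * (t * a + t * b) = (4 * E * (a + b) ^+ 2) * t ^+ 2 by ring.
  rewrite ler_wpM2r // ?sqr_ge0 //.
  have -> : e = 4 * E * ((a + b) ^+ 2 + 1) by rewrite /E; field; rewrite lt0r_neq0.
  by rewrite ler_pM2l ?lerDl // mulr_gt0.
Qed.

(** Around the small square lie two strips of full height, and one rectangle below and one above it.
    Each avoids [z0] because one of its coordinates does. *)
Lemma ddiff_boundary_hole (p q s : R) : 0 < s ->
  -1 <= p - s -> p + s <= 1 -> -1 <= q - s -> q + s <= 1 -> pt p q = z0 ->
  ddiff boundary_primitive (-1) 1 (-1) 1 =
  ddiff boundary_primitive (p - s) (p + s) (q - s) (q + s).
Proof.
move=> s0 p1 p2 q1 q2 pq.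
have -> : ddiff boundary_primitive (-1) 1 (-1) 1 =
    ddiff boundary_primitive (-1) (p - s) (-1) 1 +
    ddiff boundary_primitive (p + s) 1 (-1) 1 +
    ddiff boundary_primitive (p - s) (p + s) (-1) (q - s) +
    ddiff boundary_primitive (p - s) (p + s) (q + s) 1 +
    ddiff boundary_primitive (p - s) (p + s) (q - s) (q + s).
  by move: boundary_primitive => P; rewrite /ddiff; ring.
have hp x y : x < p \/ p < x -> pt x y != z0.
  move=> xp; apply/eqP; rewrite -pq => /(congr1 ReC); rewrite !Re_pt => xE.
  by case: xp; rewrite xE ltxx.
have hq x y : y < q \/ q < y -> pt x y != z0.
  move=> yq; apply/eqP; rewrite -pq => /(congr1 ImC); rewrite !Im_pt => yE.
  by case: yq; rewrite yE ltxx.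
have [e1 [e2 e3]] : p - s <= 1 /\ p - s <= p + s /\ -1 <= p + s by clear -s0 p1 p2; lra.
have [f1 [f2 f3]] : q - s <= 1 /\ q - s <= q + s /\ -1 <= q + s by clear -s0 q1 q2; lra.
rewrite 4?ddiff_boundary_eq0 ?add0r ?lexx ?le_N11 //.
- by move=> x y _ /andP[ky _]; apply: hq; right; apply: lt_le_trans ky; rewrite ltrDl.
- by move=> x y _ /andP[_ ky]; apply: hq; left; apply: le_lt_trans ky _; rewrite ltrBlDr ltrDl.
- by move=> x y /andP[kx _] _; apply: hp; right; apply: lt_le_trans kx; rewrite ltrDl.
- by move=> x y /andP[_ kx] _; apply: hp; left; apply: le_lt_trans kx _; rewrite ltrBlDr ltrDl.
Qed.

(* The rectangles of a grid around a small square centred at the exceptional point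
   do not contribute, and the small square contributes arbitrarily little. *)
Lemma contour_eq0 : `|z0| < 1 -> contour g = 0.
Proof.
move=> z01.
have p1 : `|ReC z0| < 1 by rewrite -rC_lt rmorph1; exact: le_lt_trans (Re_le _) z01.
have q1 : `|ImC z0| < 1 by rewrite -rC_lt rmorph1; exact: le_lt_trans (Im_le _) z01.
have z03 : `|z0| < 3 by apply: lt_trans z01 _; rewrite ltr1n.
have [d d0 dP] := (continuous_dist g z0).1 (gc z03) 1 ltr01.
move: p1 q1 (pt_ReIm z0); move: (ReC z0) (ImC z0) => p q p1 q1 pq.
pose M : C := `|g z0| + 1.
have M0 : 0 < M by rewrite /M ltr_pwDr.
have [ME M1] := gt0_rC M0; move: (ReC M) ME M1 => m ME M1.
rewrite contour_ddiff.
set D := ddiff _ _ _ _ _.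
have nE : `|D| = rC (ReC `|D|) by apply: (@ge_norm_rC _ D).
apply/eqP; rewrite -normr_le0 nE -(rmorph0 rC) rC_le leNgt; apply/negP => n0.
move: (ReC _) nE n0 => n nE n0.
(* The small square of half side s contributes at most 16 m s, which this bound on s makes smaller
   than n / 2. *)
have nm : 0 < n / (32 * m) by rewrite divr_gt0 // mulr_gt0.
have [s [s0 sd sp sq sn]] : exists s, [/\ 0 < s, 2 * s < d, s < 1 - `|p|, s < 1 - `|q|
    & s < n / (32 * m)].
  pose s0 := Num.min (Num.min (d / 2) (1 - `|p|)) (Num.min (1 - `|q|) (n / (32 * m))).
  have s00 : 0 < s0 by rewrite /s0 !lt_min !subr_gt0 p1 q1 nm divr_gt0.
  exists (s0 / 2); have : s0 / 2 < s0 by rewrite ltr_pdivrMr // mulr_natr mulr2n ltrDl.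
  rewrite {2}/s0 !lt_min => /andP[/andP[h1 h2] /andP[h3 h4]]; split=> //.
    by rewrite divr_gt0.
  by rewrite mulrC -ltr_pdivlMr.
have [[p2 p3] [q2 q3]] : (-1 <= p - s /\ p + s <= 1) /\ (-1 <= q - s /\ q + s <= 1).
  by clear -sp sq; have := ler_norm p; have := ler_norm q; have := ler_norm (- p);
    have := ler_norm (- q); rewrite !normrN; lra.
have := @ddiff_boundary 0 0 0 0 (2 * s) (2 * s) M (p - s) (p + s) (q - s) (q + s).
rewrite -ddiff_boundary_hole // -/D nE ME.
have -> : p - s <= p + s by clear -s0; lra.
have -> : q - s <= q + s by clear -s0; lra.
have -> : 4 * rC m * rC (2 * s + 2 * s) = rC (4 * m * (2 * s + 2 * s)).
  by rewrite (rmorphM rC) (rmorphM rC 4) rmorph_nat.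
rewrite rC_le; move=> /(_ p2 isT p3 q2 isT q3) H.
have {}H : n <= 4 * m * (2 * s + 2 * s).
  apply: H; [by ring | by ring |].
  move=> x y xx yy; rewrite subr0 mul0r subr0 -ME /M.
  have -> : g (pt x y) = g z0 + (g (pt x y) - g z0) by ring.
  apply: le_trans (ler_normD _ _) _; rewrite lerD2l ltW //.
  apply: dP; rewrite -pq ptB; apply: le_lt_trans (norm_pt_le _ _) _; rewrite rC_lt.
  apply: le_lt_trans sd; rewrite mulr_natl mulr2n.
  by apply: lerD; rewrite ler_distl; [move: xx | move: yy]; rewrite addrC.
have : 4 * m * (2 * s + 2 * s) < 4 * m * (4 * (n / (32 * m))).
  by rewrite ltr_pM2l ?mulr_gt0 //; clear -sn; lra.
have -> : 4 * m * (4 * (n / (32 * m))) = n / 2 by field; rewrite lt0r_neq0.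
by clear -H n0; lra.
Qed.
End Rectangle.
End Cauchy.

(** * Cauchy's formula and its consequences near the origin *)

Section CauchyFormula.
Variable R : realType.
Local Notation C := (Cplx R).
Local Notation ReC := (@complex.Re R : C -> R).
Local Notation rC := (@rC R).

(* Plays the role of [2 pi i]: only its non-vanishing for [`|z| <= 32^-1] is needed. *)
Definition winding (z : C) : C := contour (fun w => (w - z)^-1).

(** The formula is isolated as a property because it passes to uniform limits, while bounds and
    derivability at 0 follow from it without assuming [f] holomorphic. *)
Definition cauchy_rep (f : C -> C) : Prop := square_continuous f /\
  forall z, `|z| <= 32^-1 -> f z * winding z = contour (fun w => f w / (w - z)).

Lemma square_sub_ge (z w : C) : `|z| <= 2^-1 -> square w -> 2^-1 <= `|w - z|.
Proof.
move=> z1 /square_ge1 w1; apply: le_trans (lerB_dist _ _).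
apply: le_trans (lerB w1 z1).
by rewrite lerBrDr -[2^-1]mul1r -splitr.
Qed.

Lemma square_sub_neq0 (z w : C) : `|z| <= 2^-1 -> square w -> w - z != 0.
Proof.
move=> z1 ws; rewrite -normr_gt0; apply: lt_le_trans (square_sub_ge z1 ws).
by rewrite invr_gt0.
Qed.

Lemma square_subV_le (z w : C) : `|z| <= 2^-1 -> square w -> `|(w - z)^-1| <= 2.
Proof.
move=> z1 ws; rewrite normrV ?unitfE ?square_sub_neq0 //.
by rewrite invf_ple ?posrE ?square_sub_ge // normr_gt0 square_sub_neq0.
Qed.

Lemma square_neq0 (w : C) : square w -> w != 0.
Proof. by move=> /square_ge1 w1; rewrite -normr_gt0; apply: lt_le_trans w1. Qed.

Lemma square_V_le (w : C) : square w -> `|w^-1| <= 1.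
Proof.
move=> ws; rewrite normrV ?unitfE ?square_neq0 //.
by rewrite invf_ple ?posrE ?invr1 ?square_ge1 // normr_gt0 square_neq0.
Qed.

Lemma square_continuous_subV (z : C) : `|z| <= 2^-1 ->
  square_continuous (fun w => (w - z)^-1).
Proof.
move=> z1 w ws; apply: (@continuousV C C (fun w => w - z) w).
  exact: square_sub_neq0.
by apply: (@continuousB C C C); [exact: cvg_id | exact: cst_continuous].
Qed.

Lemma square_continuousM (f h : C -> C) : square_continuous f -> square_continuous h ->
  square_continuous (fun w => f w * h w).
Proof. by move=> fc hc w ws; apply: (@continuousM C C); [exact: fc | exact: hc]. Qed.

Lemma square_continuous_cst (a : C) : square_continuous (fun=> a).
Proof. by move=> w _; exact: cst_continuous. Qed.

Lemma square_continuous_V : square_continuous (fun w : C => w^-1).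
Proof.
move=> w ws; apply: (@continuousV C C id w); last exact: cvg_id.
exact: square_neq0.
Qed.

Lemma contourZ (a : C) (h : C -> C) : square_continuous h ->
  contour (fun z => a * h z) = a * contour h.
Proof.
move=> hc; have h0 := @square_continuous_cst 0.
have c0 : contour (fun=> 0 : C) = 0.
  by have := contour_lin (-1) h0 h0; rewrite mulr0 addr0 mulN1r addNr.
have := contour_lin a hc h0; rewrite c0 addr0 => <-.
by congr contour; apply/funext => z; rewrite addr0.
Qed.

Lemma contourB (h k : C -> C) : square_continuous h -> square_continuous k ->
  contour (fun z => h z - k z) = contour h - contour k.
Proof.
move=> hc kc; have := contour_lin (-1) kc hc.
rewrite mulN1r addrC => <-; congr contour; apply/funext => z.
by rewrite mulN1r addrC.
Qed.

Lemma le_32V_2V : 32^-1 <= 2^-1 :> C.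
Proof. by rewrite lef_pV2 ?posrE // ler_nat. Qed.

Lemma lt_32V_1 : 32^-1 < 1 :> C.
Proof. by rewrite invf_plt ?posrE // invr1 ltr1n. Qed.

(** The integrands differ by z / ((w - z) w), of modulus at most 2 |z| on the square. *)
Lemma winding_dist (z : C) : `|z| <= 2^-1 -> `|winding z - winding 0| <= 32 * `|z|.
Proof.
move=> z1; have c0 : `|0 : C| <= 2^-1 by rewrite normr0 invr_ge0.
have cz := square_continuous_subV z1.
have cz0 := square_continuous_subV c0.
rewrite /winding -contourB //.
have -> : 32 * `|z| = 16 * (2 * `|z|) by ring.
apply: contour_bound => [|w ws].
  by move=> w ws; apply: (@continuousB C C C); [exact: cz | exact: cz0].
have w0 := square_neq0 ws; have wz := square_sub_neq0 z1 ws.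
rewrite subr0; have -> : (w - z)^-1 - w^-1 = (w - z)^-1 * (z * w^-1) by field; rewrite w0 wz.
rewrite normrM; apply: ler_pM; rewrite ?square_subV_le //.
by rewrite normrM ler_piMr // square_V_le.
Qed.

(* The integrand is [4 'i / (t^2 + 1)], at distance at most [1] from [3 'i]. *)
Lemma winding0_ge : 2 <= `|winding 0|.
Proof.
have c0 : `|0 : C| <= 2^-1 by rewrite normr0 invr_ge0.
have := square_continuous_subV c0; rewrite /winding.
set h := (fun w : C => _) => hc.
have hE (t : R) : -1 <= t <= 1 -> side_sum h t = rC (4 / (t ^+ 2 + 1)) * 'i.
  move=> t1; rewrite /side_sum clampE // /h /pt !subr0 !rmorphN !rmorph1 mulr1 mulrN1.
  move: (t : R) => {t1} t.
  have T1 : rC t ^+ 2 + 1 = rC (t ^+ 2 + 1) by rewrite rmorphD rmorph1 (rmorphXn rC).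
  have T0 : rC t ^+ 2 + 1 != 0.
    rewrite T1 fmorph_eq0 lt0r_neq0 //.
    by rewrite ltr_wpDl // sqr_ge0.
  have AB : (rC t - 'i) * (rC t + 'i) = rC t ^+ 2 + 1 by rewrite -subr_sqr sqrCi opprK.
  have := T0; rewrite -AB mulf_eq0 => /norP[A0 B0].
  have -> : 1 + 'i * rC t = 'i * (rC t - 'i) by rewrite mulrBr -expr2 sqrCi opprK addrC.
  have -> : -1 + 'i * rC t = 'i * (rC t + 'i) by rewrite mulrDr -expr2 sqrCi addrC.
  have i0 : ('i : C) != 0 by rewrite neq0Ci.
  have -> : rC (4 / (t ^+ 2 + 1)) = 4 / (rC t ^+ 2 + 1).
    by rewrite T1 -(rmorph_nat rC 4) -(fmorphV rC) -(rmorphM rC).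
  by rewrite -AB; field; rewrite i0 A0 B0.
(* Over [-1, 1] the constant 3 'i contributes 6 'i and the deviation from it at most 2 * 1 * 2 = 4,
   which leaves 2. *)
pose F (t : R) := cprim (side_sum h) t - 3 * 'i * rC t.
have dF : cderiv F (fun t => side_sum h t - 3 * 'i * 1).
  exact: cderivB (cderiv_cprim (side_sum_ccont hc)) (cderivZ _ (@cderiv_rC R)).
have FE : contour h = F 1 - F (-1) + 6 * 'i.
  by rewrite /contour /F rmorphN rmorph1; ring.
have b : `|F 1 - F (-1)| <= 4.
  have -> : 4 = 2 * 1 * rC (1 - (-1)) by rewrite opprK rmorphD rmorph1; ring.
  apply: (cderiv_bound dF); rewrite ?le_N11 // => t t1.
  rewrite hE // mulr1 -mulrBl normrM norm_i mulr1 -(rmorph_nat rC 3) -rmorphB norm_rC.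
  rewrite -(rmorph1 rC) rC_le.
  have t2 : t ^+ 2 <= 1.
    have : 0 <= (1 - t) * (1 + t) by apply: mulr_ge0; move: t1; clear; lra.
    by clear; lra.
  have t3 : 0 < t ^+ 2 + 1 by rewrite ltr_wpDl // sqr_ge0.
  rewrite ler_distl ler_pdivlMr // ler_pdivrMr //.
  by have := sqr_ge0 t; move: t2; clear; lra.
have -> : 2 = `|6 * 'i : C| - 4 by rewrite normrM norm_i mulr1 normr_nat; ring.
rewrite FE [X in _ <= `|X|]addrC; apply: le_trans (lerB_normD _ _).
by rewrite lerD2l lerN2.
Qed.

(** Origin of the radius [32^-1]: there the winding differs by at most 1 from its value at 0, whose
    modulus is at least 2. *)
Lemma winding_ge1 (z : C) : `|z| <= 32^-1 -> 1 <= `|winding z|.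
Proof.
move=> z1; have := winding_dist (le_trans z1 le_32V_2V).
have z2 : 32 * `|z| <= 1 by rewrite -ler_pdivlMl // mulr1.
move=> /le_trans /(_ z2) h.
have -> : winding z = winding 0 + (winding z - winding 0) by ring.
apply: le_trans (lerB_normD _ _); have -> : 1 = 2 - 1 :> C by ring.
exact: lerB winding0_ge h.
Qed.

Lemma winding_neq0 (z : C) : `|z| <= 32^-1 -> winding z != 0.
Proof. by move=> /winding_ge1 h; rewrite -normr_gt0; apply: lt_le_trans h. Qed.

Lemma square_continuous_div (f : C -> C) (z : C) : `|z| <= 2^-1 ->
  square_continuous f -> square_continuous (fun w => f w / (w - z)).
Proof.
by move=> z1 fc; apply: (square_continuousM fc (square_continuous_subV z1)).
Qed.

Lemma near_eq_continuous (V : normedModType C) (f g : V -> C) (x : V) :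
  nbhs x (fun u => g u = f u) -> {for x, continuous f} -> {for x, continuous g}.
Proof.
move=> fg fc; rewrite /prop_for /continuous_at (nbhs_singleton fg) => U fU.
by apply: (filterS2 _ _ fg (fc U fU)) => u /= ->.
Qed.

(** The quotient (f w - f z) / (w - z), completed by the derivative, is continuous at z, but nothing
    is known yet about its derivability there. This is why Goursat's theorem admits an exceptional
    point. *)
Lemma holomorphic_cauchy_rep (f : C -> C) :
  (forall z : C, `|z| < 3 -> {for z, continuous f}) ->
  (forall z : C, `|z| < 3 -> derivable f z 1) -> cauchy_rep f.
Proof.
move=> fc fd; have fs : square_continuous f by move=> z /square_lt; exact: fc.
split=> // z z1; have z2 := le_trans z1 le_32V_2V.
have z3 : `|z| < 1 := le_lt_trans z1 lt_32V_1.
have z4 : `|z| < 3 by apply: lt_trans z3 _; rewrite ltr1n.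
have [c cP] := derivable_local (fd z z4).
pose g (w : C) : C := if w == z then c else (f w - f z) * (w - z)^-1.
have gE w : w != z -> nbhs w (fun u => g u = (f u - f z) * (u - z)^-1).
  move=> wz; have wz0 : 0 < `|w - z| by rewrite normr_gt0 subr_eq0.
  apply/nbhs_ballP; exists `|w - z| => // u; rewrite -ball_normE /= /g => uw.
  by case: eqP uw => // ->; rewrite ltxx.
have gc w : `|w| < 3 -> {for w, continuous g}.
  move=> w3; have [->|wz] := eqVneq w z.
    apply/continuous_dist => e /gt0_rC[-> e0].
    have [|d d0 dP] := cP (ReC e / 2); first by rewrite divr_gt0.
    exists d => // u uz; have [->|uz0] := eqVneq u z.
      by rewrite subrr normr0 -(rmorph0 rC) rC_lt.
    rewrite /g eqxx (negbTE uz0).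
    have uz1 : u - z != 0 by rewrite subr_eq0.
    have -> : (f u - f z) / (u - z) - c = (f u - f z - c * (u - z)) / (u - z) by field.
    rewrite normrM normrV ?unitfE // ltr_pdivrMr ?normr_gt0 //.
    apply: le_lt_trans (dP u uz) _; rewrite ltr_pM2r ?normr_gt0 // rC_lt.
    by rewrite ltr_pdivrMr // mulr_natr mulr2n ltrDl.
  apply: near_eq_continuous (gE w wz) _.
  apply: (@continuousM C C).
    by apply: (@continuousB C C C); [exact: fc | exact: cst_continuous].
  apply: (@continuousV C C (fun u => u - z) w); first by rewrite subr_eq0.
  by apply: (@continuousB C C C); [exact: cvg_id | exact: cst_continuous].
have gd w : `|w| < 3 -> w != z -> derivable g w 1.
  move=> w3 wz; apply: (near_eq_derivable (f := fun u => (f u - f z) * (u - z)^-1)).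
    by apply: filterS (gE w wz) => u ->.
  apply: (@derivableM C C); first by apply: derivableB => //; exact: fd.
  apply: derivableV; first by rewrite subr_eq0.
  exact: derivableB.
have := contour_eq0 gc gd z3.
rewrite (@eq_contour _ g (fun w => f w / (w - z) - f z * (w - z)^-1)).
- rewrite contourB ?contourZ.
  + by move=> /eqP; rewrite subr_eq0 => /eqP ->.
  + exact: square_continuous_subV.
  + exact: square_continuous_div.
  + exact: square_continuousM (@square_continuous_cst _) (square_continuous_subV z2).
- by move=> w /square_lt; exact: gc.
- move=> w ws; apply: (@continuousB C C C); first exact: square_continuous_div.
  exact: (square_continuousM (@square_continuous_cst _) (square_continuous_subV z2)).
- move=> w ws; rewrite /g; have := square_sub_neq0 z2 ws.
  by rewrite subr_eq0 => /negbTE ->; rewrite mulrBl.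
Qed.

Lemma cauchy_rep_bound (f : C -> C) (M z : C) : cauchy_rep f ->
  (forall w, square w -> `|f w| <= M) -> `|z| <= 32^-1 -> `|f z| <= 32 * M.
Proof.
move=> [fs fE] fM z1; have z2 := le_trans z1 le_32V_2V.
apply: (@le_trans _ _ (`|f z| * `|winding z|)).
  by rewrite ler_peMr // winding_ge1.
rewrite -normrM fE //; have -> : 32 * M = 16 * (M * 2) by ring.
apply: contour_bound => [|w ws]; first exact: square_continuous_div.
rewrite normrM; apply: ler_pM => //; first exact: fM.
exact: square_subV_le.
Qed.

(** Meant for a directional derivative, a uniform limit of difference quotients. Both sides of the
    formula are controlled by the sup norm: one through |winding z|, the other through 16 * 2. *)
Lemma cauchy_rep_lim (f : C -> C) : square_continuous f ->
  (forall e : C, 0 < e -> exists2 h, cauchy_rep h &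
     forall z : C, `|z| < 3 -> `|f z - h z| <= e) -> cauchy_rep f.
Proof.
move=> fs fh; split=> // z z1; have z2 := le_trans z1 le_32V_2V.
have z3 : `|z| < 3 by apply: le_lt_trans z1 (lt_trans lt_32V_1 _); rewrite ltr1n.
apply/eqP; rewrite -subr_eq0 -normr_le0.
have K0 : 0 < `|winding z| + 32 by rewrite ltr_wpDl.
apply/ler_addgt0Pr => e e0; rewrite add0r.
have [|h [hs hE] hf] := fh (e / (`|winding z| + 32)); first by rewrite divr_gt0.
have -> : f z * winding z - contour (fun w => f w / (w - z)) =
    (f z - h z) * winding z - contour (fun w => (f w - h w) / (w - z)).
  have -> : (fun w => (f w - h w) / (w - z)) = (fun w => f w / (w - z) - h w / (w - z)).
    by apply/funext => w; rewrite mulrBl.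
  rewrite (contourB (square_continuous_div z2 fs) (square_continuous_div z2 hs)).
  rewrite -(hE z z1) mulrBl.
  by move: (f z * _) (h z * _) (contour _) => *; ring.
set d := e / _ in hf.
have -> : e = d * `|winding z| + 16 * (d * 2).
  by rewrite /d; field; rewrite lt0r_neq0.
apply: le_trans (ler_normB _ _) (lerD _ _).
  by rewrite normrM ler_wpM2r // hf.
apply: contour_bound => [|w ws].
  apply: (square_continuous_div z2) => w ws.
  by apply: (@continuousB C C C); [exact: fs | exact: hs].
rewrite normrM; apply: ler_pM => //; first exact/hf/square_lt.
exact: square_subV_le.
Qed.

(** For h = f - f 0, expand 1 / (w - z) = 1 / w + z / w^2 + z^2 / (w^2 (w - z)): the first term
    contributes 0 because h 0 = 0, the second gives the coefficient c, the third is quadratic. The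
    winding varies with z, but replacing it by its value at 0 costs only another O(z^2), by
    [winding_dist]. With |h| <= 33 M, the two errors add up to 16 * 33 * (32 + 2) M. *)
Lemma cauchy_rep_quadratic (f : C -> C) (M : C) : cauchy_rep f ->
  (forall w, square w -> `|f w| <= M) ->
  exists c : C, forall z, `|z| <= 32^-1 ->
    `|f z - f 0 - c * z| <= 16 * 33 * 34 * M * `|z| ^+ 2.
Proof.
move=> fr fM; have [fs fE] := fr.
have z01 : `|0 : C| <= 32^-1 by rewrite normr0 invr_ge0.
have z02 := le_trans z01 le_32V_2V.
have f0M := cauchy_rep_bound fr fM z01.
pose h w := f w - f 0.
have hs : square_continuous h.
  by move=> w ws; apply: (@continuousB C C C); [exact: fs | exact: cst_continuous].
have hM w : square w -> `|h w| <= 33 * M.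
  move=> ws; have -> : 33 * M = M + 32 * M by ring.
  by apply: le_trans (ler_normB _ _) (lerD (fM w ws) f0M).
have hV : square_continuous (fun w => h w * w^-1).
  exact: (square_continuousM _ square_continuous_V).
have hE z : `|z| <= 32^-1 -> h z * winding z = contour (fun w => h w / (w - z)).
  move=> z1; have z2 := le_trans z1 le_32V_2V; rewrite /h.
  have -> : (fun w => (f w - f 0) / (w - z)) = (fun w => f w / (w - z) - f 0 * (w - z)^-1).
    by apply/funext => w; rewrite mulrBl.
  have s1 := square_continuous_div z2 fs; have s2 := square_continuous_subV z2.
  rewrite (contourB s1 (square_continuousM (@square_continuous_cst (f 0)) s2)).
  by rewrite (contourZ _ s2) -(fE z z1) mulrBl.
have h0 : contour (fun w => h w * w^-1) = 0.
  have -> : (fun w => h w * w^-1) = (fun w => h w / (w - 0)).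
    by apply/funext => w; rewrite subr0.
  by rewrite -(hE 0 z01) /h subrr mul0r.
pose h2 w := h w * w^-1 * w^-1.
have h2s : square_continuous h2 := square_continuousM hV square_continuous_V.
have h2M w : square w -> `|h2 w| <= 33 * M.
  move=> ws; rewrite !normrM; apply: le_trans (hM w ws).
  rewrite -mulrA ler_piMr //.
  by apply: mulr_ile1 => //; apply: square_V_le.
pose b := contour h2.
have bM : `|b| <= 16 * (33 * M) := contour_bound h2s h2M.
have N0 := winding_neq0 z01.
exists (b / winding 0) => z z1; have z2 := le_trans z1 le_32V_2V.
have Nz := winding_neq0 z1.
pose h3 w := h2 w / (w - z).
have h3s : square_continuous h3 := square_continuous_div z2 h2s.
pose r := contour h3.
have rM : `|r| <= 16 * (33 * M * 2).
  apply: contour_bound => // w ws.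
  by rewrite normrM; apply: ler_pM; rewrite ?square_subV_le ?h2M.
have hz : h z * winding z = z * b + z ^+ 2 * r.
  rewrite hE //.
  have zs : square_continuous (fun w => z ^+ 2 * h3 w).
    exact: (square_continuousM (@square_continuous_cst _) h3s).
  have zzs : square_continuous (fun w => z * h2 w + z ^+ 2 * h3 w).
    move=> w ws; apply: (@continuousD C C C); last exact: zs.
    exact: (square_continuousM (@square_continuous_cst _) h2s).
  have zzzs : square_continuous (fun w => 1 * (h w * w^-1) + (z * h2 w + z ^+ 2 * h3 w)).
    move=> w ws; apply: (@continuousD C C C); last exact: zzs.
    exact: (square_continuousM (@square_continuous_cst _) hV).
  rewrite (eq_contour (square_continuous_div z2 hs) zzzs) => [|w ws].
    by rewrite (contour_lin 1 hV zzs) h0 mulr0 add0r (contour_lin z h2s zs) (contourZ _ h3s).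
  have w0 := square_neq0 ws; have wz := square_sub_neq0 z2 ws.
  by rewrite /h3 /h2; move: (h w) => u; field; rewrite w0 wz.
have fz : f z - f 0 = (z * b + z ^+ 2 * r) / winding z by rewrite -hz mulfK.
have -> : f z - f 0 - b / winding 0 * z =
    (z * b * (winding 0 - winding z) / winding 0 + z ^+ 2 * r) / winding z.
  rewrite fz; move: (winding z) (winding 0) Nz N0 => u v u0 v0.
  by field; rewrite u0 v0.
have V1 (u : C) : 1 <= `|u| -> `|u^-1| <= 1.
  move=> u1; have u0 : u != 0 by rewrite -normr_gt0; apply: lt_le_trans u1.
  by rewrite normrV ?unitfE // invf_ple ?posrE ?invr1 // normr_gt0.
rewrite normrM.
apply: (@le_trans _ _ (`|z * b * (winding 0 - winding z) / winding 0 + z ^+ 2 * r|)).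
  by rewrite ler_piMr // V1 // winding_ge1.
have -> : 16 * 33 * 34 * M * `|z| ^+ 2 = `|z| * (16 * (33 * M)) * (32 * `|z|) * 1
    + `|z| ^+ 2 * (16 * (33 * M * 2)) by ring.
apply: le_trans (ler_normD _ _) (lerD _ _).
  rewrite !normrM; apply: ler_pM; rewrite ?mulr_ge0 ?V1 ?winding_ge1 //.
  apply: ler_pM; rewrite ?mulr_ge0 //; last by rewrite distrC winding_dist.
  exact: ler_wpM2l.
by rewrite normrM normrX; apply: ler_wpM2l => //; rewrite exprn_ge0.
Qed.

Lemma cauchy_rep_derivable (f : C -> C) (M : C) : cauchy_rep f ->
  (forall w, square w -> `|f w| <= M) -> derivable f 0 1 /\
  forall z, `|z| <= 32^-1 ->
    `|f z - f 0 - 'D_1 f 0 * z| <= 16 * 33 * 34 * M * `|z| ^+ 2.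
Proof.
move=> fr fM; have [c cP] := cauchy_rep_quadratic fr fM.
have M0 : 0 <= M.
  apply: le_trans (fM (pt 1 1) _) => //.
  by apply: square2; rewrite lexx le_N11.
set K := 16 * 33 * 34 * M in cP *.
have K0 : 0 <= K by rewrite !mulr_ge0.
have fc : h^-1 *: (f (h *: 1 + 0) - f 0) @[h --> 0^'] --> c.
  apply/(@cvgrPdist_lt C C C _ _ _ c) => e e0.
  near=> h.
  have h0 : h != 0 by near: h; exact: nbhs_dnbhs_neq.
  have h1 : `|h| <= 32^-1 by near: h; apply: dnbhs0_le.
  have h2 : `|h| < e / (K + 1) by near: h; apply: dnbhs0_lt; rewrite divr_gt0 // ltr_wpDl.
  have := cP h h1; rewrite [h *: 1]mulr1 addr0.
  have -> : c - h^-1 *: (f h - f 0) = - ((f h - f 0 - c * h) / h).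
    by rewrite /GRing.scale /=; field.
  rewrite normrN normrM normrV ?unitfE // => hK.
  have hp : 0 < `|h| by rewrite normr_gt0.
  apply: (@le_lt_trans _ _ (K * `|h|)); first by rewrite ler_pdivrMr // -mulrA -expr2.
  apply: (@le_lt_trans _ _ ((K + 1) * `|h|)); first by rewrite ler_wpM2r // lerDl.
  by rewrite mulrC -ltr_pdivlMr // ltr_wpDl.
have fd : derivable f 0 1 by apply/cvg_ex; exists c.
split=> // z; suff -> : 'D_1 f 0 = c by exact: cP.
by apply: cvg_lim fc.
Unshelve. all: by end_near.
Qed.
End CauchyFormula.

(** * Several variables: derivatives and the identity theorem *)

Section SeveralVariables.
Variable R : realType.
Local Notation C := (Cplx R).
Local Notation ReC := (@complex.Re R : C -> R).
Local Notation rC := (@rC R).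
Variable V : normedModType C.
Implicit Types (g : V -> C) (D : set V) (x y v w : V).

Lemma derive_dist g y v (c : C) : is_derive y v g c <->
  (forall e : C, 0 < e -> exists2 d : C, 0 < d & forall h : C, h != 0 -> `|h| < d ->
     `|c - h^-1 * (g (h *: v + y) - g y)| < e).
Proof.
split=> [gd e e0|H].
  have gc : h^-1 *: (g (h *: v + y) - g y) @[h --> 0^'] --> c.
    by have := (@ex_derive _ _ _ _ _ _ _ gd); rewrite -(@derive_val _ _ _ _ _ _ _ gd).
  have /nbhs_ballP[d d0 dP] :
      nbhs (0^' : set_system C) (fun h => `|c - h^-1 *: (g (h *: v + y) - g y)| < e).
    exact: (@cvgrPdist_lt C C C _ _ _ c).1 gc _ e0.
  exists d => // h h0 hd; apply: (dP h) => //.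
  by rewrite -ball_normE /= sub0r normrN.
have gc : h^-1 *: (g (h *: v + y) - g y) @[h --> 0^'] --> c.
  apply/(@cvgrPdist_lt C C C _ _ _ c) => e /H[d d0 dP].
  apply/nbhs_ballP; exists d => // h; rewrite -ball_normE /= sub0r normrN => hd h0.
  exact: dP.
have gd : derivable g y v by apply/cvg_ex; exists c.
by apply: DeriveDef => //; apply: cvg_lim gc.
Qed.

(** Lets a direction be replaced by a multiple short enough for the disc of radius 3 on its line to
    stay in the domain. *)
Lemma is_deriveZv g y v (k c : C) : k != 0 -> is_derive y v g c ->
  is_derive y (k *: v) g (k * c).
Proof.
move=> k0 /derive_dist H; apply/derive_dist => e e0.
have k1 : 0 < `|k| by rewrite normr_gt0.
have [|d d0 dP] := H (e / `|k|); first by rewrite divr_gt0.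
exists (d / `|k|) => [|h h0 hd]; first by rewrite divr_gt0.
have := dP (h * k); rewrite mulf_neq0 // normrM -ltr_pdivlMr // => /(_ isT hd).
rewrite scalerA ltr_pdivlMr // mulrC -normrM.
suff -> : k * (c - (h * k)^-1 * (g ((h * k) *: v + y) - g y)) =
  k * c - h^-1 * (g ((h * k) *: v + y) - g y) by [].
by move: (g _ - g y) => u; field; rewrite h0 k0.
Qed.

(* Weaker than [differentiable] on [D], but enough for the identity theorem and easily
   seen to be stable under derivation. *)
Definition gholomorphic D g : Prop := forall x, D x ->
  {for x, continuous g} /\ forall v, derivable g x v.

Lemma is_derive_line g y v (t c : C) : is_derive (t *: v + y) v g c <->
  is_derive t 1 (fun s : C => g (s *: v + y)) c.
Proof.
have E h : h *: v + (t *: v + y) = (h *: 1 + t) *: v + y.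
  by rewrite [h *: 1]mulr1 scalerDl addrA.
have F : (fun h : C => h^-1 *: (g (h *: v + (t *: v + y)) - g (t *: v + y))) =
    (fun h : C => h^-1 *: (g ((h *: 1 + t) *: v + y) - g (t *: v + y))).
  by apply/funext => h; rewrite E.
have Fd : derivable g (t *: v + y) v = derivable (fun s : C => g (s *: v + y)) t 1.
  by rewrite /derivable F.
have FD : 'D_v g (t *: v + y) = 'D_1 (fun s : C => g (s *: v + y)) t.
  by rewrite /derive F.
split=> -[gd1 gd2].
  by apply: DeriveDef; [rewrite -Fd; exact: gd1 | rewrite -FD; exact: gd2].
by apply: DeriveDef; [rewrite Fd; exact: gd1 | rewrite FD; exact: gd2].
Qed.

Lemma continuous_line g y v (t : C) : {for t *: v + y, continuous g} ->
  {for t, continuous (fun s : C => g (s *: v + y))}.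
Proof.
move=> gc; apply: (@continuous_comp _ _ _ (fun s : C => s *: v + y) g) => //.
apply: (@continuousD C V C); last exact: cst_continuous.
by apply: (@continuousZl C V C); exact: cvg_id.
Qed.

Lemma line_cauchy_rep D g y v : gholomorphic D g ->
  (forall t : C, `|t| < 3 -> D (t *: v + y)) -> cauchy_rep (fun t : C => g (t *: v + y)).
Proof.
move=> gh Dv; apply: holomorphic_cauchy_rep => t t3.
  by apply: continuous_line; have [] := gh _ (Dv t t3).
have [_ /(_ v) /derivableP /is_derive_line gd] := gh _ (Dv t t3).
exact: ex_derive.
Qed.

Lemma local_bound D g x : open D -> gholomorphic D g -> D x ->
  exists2 r : C, 0 < r & forall y, `|y - x| < r -> D y /\ `|g y| <= `|g x| + 1.
Proof.
move=> Do gh Dx; have [gc _] := gh x Dx.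
have [d d0 dP] := (continuous_dist g x).1 gc 1 ltr01.
have /nbhs_ballP[e /gt0_rC[-> e0] eP] := open_nbhs_nbhs (conj Do Dx).
exists (rC (Num.min d (ReC e))) => [|y yx].
  by rewrite -(rmorph0 rC) rC_lt lt_min d0.
split.
  apply: eP; rewrite -ball_normE /= distrC; apply: lt_le_trans yx _.
  by rewrite rC_le ge_min lexx orbT.
have -> : g y = g x + (g y - g x) by ring.
apply: le_trans (ler_normD _ _) _; rewrite lerD2l ltW // dP //.
by apply: lt_le_trans yx _; rewrite rC_le ge_min lexx.
Qed.

Definition taylor_const (M : C) : C := 16 * 33 * 34 * M.

Lemma taylor_const_ge0 (M : C) : 0 <= M -> 0 <= taylor_const M.
Proof. by move=> M0; rewrite mulr_ge0 // !mulr_ge0. Qed.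

(** The constant depends on [M] alone, so the difference quotients converge to the derivative
    uniformly in the base point. *)
Lemma taylor_line D g y v (M : C) : gholomorphic D g ->
  (forall t : C, `|t| < 3 -> D (t *: v + y) /\ `|g (t *: v + y)| <= M) ->
  forall t : C, `|t| <= 32^-1 ->
    `|g (t *: v + y) - g y - 'D_v g y * t| <= taylor_const M * `|t| ^+ 2.
Proof.
move=> gh Dv t t1; pose f (s : C) := g (s *: v + y).
have fr : cauchy_rep f by apply: line_cauchy_rep gh _ => s /Dv[].
have fM z : square z -> `|f z| <= M by move=> /square_lt /Dv[].
have [fd fq] := cauchy_rep_derivable fr fM.
have := fq t t1; rewrite /f scale0r add0r.
suff -> : 'D_1 (fun s : C => g (s *: v + y)) 0 = 'D_v g y by [].
have [gd gv] := (is_derive_line g y v 0 _).2 (derivableP fd).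
have y0 : 0 *: v + y = y by rewrite scale0r add0r.
by rewrite y0 in gv; exact: esym gv.
Qed.

(** * Regularity of directional derivatives *)

Section DeriveSmall.
Variables (D : set V) (g : V -> C) (x : V) (r M : C) (w : V).
Hypotheses (gh : gholomorphic D g) (r0 : 0 < r).
Hypothesis xr : forall y, `|y - x| < r -> D y /\ `|g y| <= M.
Hypothesis wr : 3 * `|w| <= r / 2.

Let K := taylor_const M.
Let q (t : C) y := t^-1 * (g (t *: w + y) - g y).

Let M0 : 0 <= M.
Proof. by have [|_] := xr (y := x); [rewrite subrr normr0 | apply: le_trans]. Qed.

Let K0 : 0 <= K.
Proof. exact: taylor_const_ge0. Qed.

Let line_in (t : C) y : `|t| <= 3 -> `|y - x| < r / 2 -> `|t *: w + y - x| < r.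
Proof.
move=> t3 yx; rewrite -addrA [r](splitr r); apply: le_lt_trans (ler_normD _ _) _.
apply: ler_ltD => //; rewrite normrZ; apply: le_trans wr.
exact: ler_wpM2r.
Qed.

Let quotient_dist (t : C) y : t != 0 -> `|t| <= 32^-1 -> `|y - x| < r / 2 ->
  `|'D_w g y - q t y| <= K * `|t|.
Proof.
move=> t0 t1 yx; have t2 : 0 < `|t| by rewrite normr_gt0.
have h := taylor_line gh (fun (t : C) t3 => xr (line_in (ltW t3) yx)) t1.
rewrite -(ler_pM2r t2) -mulrA -expr2 -normrM; apply: le_trans h.
rewrite le_eqVlt; apply/orP; left; apply/eqP.
rewrite -normrN; congr `|_|; rewrite /q; move: (g _) (g y) => a b.
by field.
Qed.

Let small (e : C) : 0 < e -> exists t : C, [/\ t != 0, `|t| <= 32^-1 & K * `|t| < e].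
Proof.
move=> e0; have eK : 0 < e + K by rewrite ltr_pwDl.
have t0 : 0 < 32^-1 * (e / (e + K)) by rewrite mulr_gt0 ?invr_gt0 // divr_gt0.
exists (32^-1 * (e / (e + K))); rewrite gt_eqF // gtr0_norm //; split=> //.
  by rewrite ler_piMr ?invr_ge0 // ler_pdivrMr // mul1r lerDl.
have -> : K * (32^-1 * (e / (e + K))) = 32^-1 * (K / (e + K)) * e by ring.
rewrite gtr_pMl //; apply: le_lt_trans _ (@lt_32V_1 R).
by rewrite ler_piMr ?invr_ge0 // ler_pdivrMr // mul1r lerDr ltW.
Qed.

Let x_in : `|x - x| < r / 2.
Proof. by rewrite subrr normr0 divr_gt0. Qed.

Let t_le3 (t : C) : `|t| <= 32^-1 -> `|t| <= 3.
Proof.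
move=> t1; have h : 1 <= 3 :> C by rewrite ler1n.
exact: le_trans t1 (le_trans (ltW (@lt_32V_1 R)) h).
Qed.

Lemma derive_continuous_small : {for x, continuous ('D_w g)}.
Proof.
apply/continuous_dist => e e0.
have e3 : 0 < e / 3 by rewrite divr_gt0.
have [t [t0 t1 tK]] := small e3.
have qc : {for x, continuous (q t)}.
  apply: (@continuousM C V); first exact: cst_continuous.
  have gc y : `|y - x| < r -> {for y, continuous g}.
    by move=> yx; have [] := gh (xr yx).1.
  apply: (@continuousB C C V); last by apply: gc; rewrite subrr normr0.
  apply: (@continuous_comp _ _ _ (fun y => t *: w + y) g).
    by apply: (@continuousD C V V); [exact: cst_continuous | exact: cvg_id].
  exact: gc _ (line_in (t_le3 t1) x_in).
have [d d0 dP] := (continuous_dist _ _).1 qc _ e3.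
have /gt0_rC[rE r1] := r0.
exists (Num.min d (ReC r / 2)) => [|y yx].
  by rewrite lt_min d0 divr_gt0.
have yr : `|y - x| < r / 2.
  apply: lt_le_trans yx _; rewrite rE -(rmorph_nat rC 2) -(fmorphV rC) -(rmorphM rC) rC_le.
  by rewrite ge_min lexx orbT.
have -> : 'D_w g y - 'D_w g x = ('D_w g y - q t y) + (q t y - q t x) - ('D_w g x - q t x).
  by move: (q t x) (q t y) ('D_w g x) ('D_w g y) => *; ring.
have -> : e = e / 3 + e / 3 + e / 3 by field.
apply: le_lt_trans (ler_normB _ _) (ltrD _ _); last first.
  exact: le_lt_trans (quotient_dist t0 t1 x_in) tK.
apply: le_lt_trans (ler_normD _ _) (ltrD _ _).
  exact: le_lt_trans (quotient_dist t0 t1 yr) tK.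
apply: dP; apply: lt_le_trans yx _; rewrite rC_le.
by rewrite ge_min lexx.
Qed.

Hypothesis derive_continuous : forall y, `|y - x| < r / 2 ->
  {for y, continuous ('D_w g)}.

(** Restricted to the line through x in direction v, the quotients [q t] satisfy Cauchy's formula,
    hence so does their uniform limit, which is therefore derivable at 0. *)
Lemma derive_derivable_small v : 3 * `|v| <= r / 4 -> derivable ('D_w g) x v.
Proof.
move=> vr; pose f (s : C) : C := 'D_w g (s *: v + x).
have r4 : r / 4 < r / 2 by rewrite ltr_pM2l // ltf_pV2 ?posrE // ltr_nat.
have sv (s : C) : `|s| < 3 -> `|s *: v + x - x| < r / 2.
  move=> s3; rewrite addrK normrZ; apply: le_lt_trans r4.
  by apply: le_trans vr; apply: ler_wpM2r => //; exact: ltW.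
have fc (s : C) : `|s| < 3 -> {for s, continuous f}.
  by move=> s3; exact: (continuous_line (derive_continuous (sv s s3))).
have fs : square_continuous f by move=> z /square_lt; exact: fc.
have fr : cauchy_rep f.
  apply: cauchy_rep_lim => // e e0; have [t [t0 t1 tK]] := small e0.
  exists (fun s => q t (s *: v + x)).
    have E : (fun s : C => q t (s *: v + x)) =
        (fun s : C => t^-1 * (g (s *: v + (t *: w + x)) - g (s *: v + x))).
      by apply/funext => s; rewrite /q addrCA.
    have gs (s : C) : `|s| < 3 -> D (s *: v + x).
      move=> s3; apply: (xr (lt_trans (sv s s3) _)).1.
      by rewrite ltr_pdivrMr // mulr_natr mulr2n ltrDl.
    have gts (s : C) : `|s| < 3 -> D (s *: v + (t *: w + x)).
      by move=> s3; rewrite addrCA; apply: (xr (line_in (t_le3 t1) (sv s s3))).1.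
    rewrite E; apply: holomorphic_cauchy_rep => s s3.
      apply: (@continuousM C C); first exact: cst_continuous.
      apply: (@continuousB C C C).
        by apply: continuous_line; have [] := gh (gts s s3).
      by apply: continuous_line; have [] := gh (gs s s3).
    apply: (@derivableM C C); first exact: derivable_cst.
    apply: derivableB.
      have [_ /(_ v) /derivableP /is_derive_line gd] := gh (gts s s3).
      exact: ex_derive.
    have [_ /(_ v) /derivableP /is_derive_line gd] := gh (gs s s3).
    exact: ex_derive.
  by move=> s s3; apply: le_trans (quotient_dist t0 t1 (sv s s3)) (ltW tK).
(* A single quotient, bounded by |t^-1| (M + M), is enough to bound the derivative on the square. *)
have [t [t0 t1 _]] := small ltr01.
have fM z : square z -> `|f z| <= K * `|t| + `|t^-1| * (M + M).
  move=> /square_lt z3; have zr := sv z z3.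
  have -> : f z = f z - q t (z *: v + x) + q t (z *: v + x) by rewrite subrK.
  apply: le_trans (ler_normD _ _) (lerD _ _); first exact: quotient_dist.
  rewrite normrM ler_wpM2l //; apply: le_trans (ler_normB _ _) (lerD _ _).
    by apply: (xr _).2; apply: line_in => //; exact: t_le3.
  apply: (xr _).2; apply: lt_trans zr _.
  by rewrite ltr_pdivrMr // mulr_natr mulr2n ltrDl.
have [fd _] := cauchy_rep_derivable fr fM.
have [] := (is_derive_line ('D_w g) x v 0 _).2 (derivableP fd).
by have -> : 0 *: v + x = x by rewrite scale0r add0r.
Qed.
End DeriveSmall.

(** Directions are shortened to meet the smallness conditions above. Continuity comes first on all
    of [D], since derivability at a point uses it on a neighbourhood. *)
Lemma gholomorphic_derive D g w : open D -> gholomorphic D g -> gholomorphic D ('D_w g).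
Proof.
move=> Do gh.
have w1 : 0 < `|w| + 1 by rewrite ltr_wpDl.
have scale x (k : C) : D x -> 'D_(k *: w) g x = k * 'D_w g x.
  move=> Dx; have [->|k0] := eqVneq k 0; first by rewrite scale0r derive0 mul0r.
  have [_ /(_ w) /derivableP gd] := gh x Dx.
  by have [_ ->] := is_deriveZv k0 gd.
have nearD x : D x -> nbhs x D by move=> Dx; apply: open_nbhs_nbhs.
have unscale x (k : C) : D x -> k != 0 ->
    nbhs x (fun y => 'D_w g y = k^-1 * 'D_(k *: w) g y).
  by move=> Dx k0; apply: filterS (nearD x Dx) => y Dy; rewrite scale // mulKf.
have cont x : D x -> {for x, continuous ('D_w g)}.
  move=> Dx; have [r r0 xr] := local_bound Do gh Dx.
  pose k : C := r / 6 / (`|w| + 1).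
  have k0 : 0 < k by rewrite !divr_gt0.
  apply: near_eq_continuous (unscale x k Dx _) _; first by rewrite gt_eqF.
  apply: (@continuousM C V); first exact: cst_continuous.
  apply: (@derive_continuous_small D g x r _ _ gh r0 xr).
  rewrite normrZ gtr0_norm //.
  have -> : 3 * (k * `|w|) = r / 2 * (`|w| / (`|w| + 1)).
    by rewrite /k; move: (`|w|) w1 => u u1; field; rewrite gt_eqF.
  rewrite ler_piMr ?divr_ge0 ?(ltW r0) //.
  by rewrite ler_pdivrMr // mul1r lerDl.
move=> x Dx; split=> [|v]; first exact: cont.
have [r r0 xr] := local_bound Do gh Dx.
pose k : C := r / 6 / (`|w| + 1).
have k0 : 0 < k by rewrite !divr_gt0.
apply: (@near_eq_derivable _ _ _ (fun y => k^-1 * 'D_(k *: w) g y)).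
  by apply: filterS (unscale x k Dx (lt0r_neq0 k0)) => y ->.
apply: (@derivableM C V); first exact: derivable_cst.
have v1 : 0 < `|v| + 1 by rewrite ltr_wpDl.
(* The factor r / 12 gives 3 |l v| <= r / 4, as r / 6 gave 3 |k w| <= r / 2; the added 1 covers zero
   vectors. *)
pose l : C := r / 12 / (`|v| + 1).
have l0 : 0 < l by rewrite !divr_gt0.
have -> : v = l^-1 *: (l *: v) by rewrite scalerA mulVf ?scale1r ?gt_eqF.
have dl : derivable ('D_(k *: w) g) x (l *: v).
  apply: (@derive_derivable_small D g x r _ (k *: w) gh r0 xr).
  - rewrite normrZ gtr0_norm //.
    have -> : 3 * (k * `|w|) = r / 2 * (`|w| / (`|w| + 1)).
      by rewrite /k; move: (`|w|) w1 => u u1; field; rewrite gt_eqF.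
    rewrite ler_piMr ?divr_ge0 ?(ltW r0) //.
    by rewrite ler_pdivrMr // mul1r lerDl.
  - move=> y yx; have Dy : D y.
      apply: (xr y (lt_trans yx _)).1.
      by rewrite ltr_pdivrMr // mulr_natr mulr2n ltrDl.
    apply: (@near_eq_continuous _ _ (fun y => k * 'D_w g y)).
      by apply: filterS (nearD y Dy) => u Du; rewrite scale.
    by apply: (@continuousM C V); [exact: cst_continuous | exact: cont].
  - rewrite normrZ gtr0_norm //.
    have -> : 3 * (l * `|v|) = r / 4 * (`|v| / (`|v| + 1)).
      by rewrite /l; move: (`|v|) v1 => u u1; field; rewrite gt_eqF.
    rewrite ler_piMr ?divr_ge0 ?(ltW r0) //.
    by rewrite ler_pdivrMr // mul1r lerDl.
have li : l^-1 != 0 by rewrite invr_neq0 // gt_eqF.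
by have [] := is_deriveZv li (derivableP dl).
Qed.

Lemma expr_le_eq0 (a b : C) : (forall n, `|a| * 32 ^+ n <= b) -> a = 0.
Proof.
move=> ab; apply/eqP; rewrite -normr_le0.
have aE : `|a| = rC (ReC `|a|) by apply: (@ge_norm_rC _ a).
have bE : b = rC (ReC b).
  by apply: (@ge_norm_rC _ a); have := ab 0%N; rewrite mulr1.
move: (ReC `|a|) (ReC b) aE bE => u v aE bE.
rewrite aE -(rmorph0 rC) rC_le leNgt; apply/negP => u0.
have v0 : 0 <= v.
  have := ab 0%N; rewrite mulr1 aE bE rC_le; exact: le_trans (ltW u0).
have [n vn] : exists n : nat, v / u < n%:R.
  by exists (Num.bound (v / u)); rewrite archi_boundP // divr_ge0 // ltW.
have := ab n; rewrite aE bE -(rmorph_nat rC 32) -(rmorphXn rC) -(rmorphM rC) rC_le.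
apply/negP; rewrite -ltNge; move: vn; rewrite ltr_pdivrMr // => vn.
apply: lt_le_trans vn _; rewrite mulrC ler_wpM2l ?(ltW u0) //.
rewrite -natrX ler_nat; exact: ltnW (ltn_expl _ _).
Qed.

(* Dividing by [t ^+ n] does not increase [`|f|] on the contour, where [1 <= `|t|],
   but multiplies the value at [32^-1] by [32 ^+ n]. *)
Lemma cauchy_zero_near (f : C -> C) (M : C) :
  (forall z : C, `|z| < 3 -> {for z, continuous f}) ->
  (forall z : C, `|z| < 3 -> derivable f z 1) ->
  (forall z : C, `|z| < 3 -> `|f z| <= M) ->
  nbhs (0 : C) (fun z => f z = 0) -> f 32^-1 = 0.
Proof.
move=> fc fd fM f0; apply: (@expr_le_eq0 _ (32 * M)) => n.
pose h (t : C) : C := f t * (t ^+ n)^-1.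
have h0 : nbhs (0 : C) (fun z => h z = 0).
  by apply: filterS f0 => z z0; rewrite /h z0 mul0r.
have hr : cauchy_rep h.
  apply: holomorphic_cauchy_rep => z z3; have [->|z0] := eqVneq z 0.
  - by apply: near_eq_continuous h0 _; exact: cst_continuous.
  - apply: (@continuousM C C); first exact: fc.
    apply: (@continuousV C C (fun t => t ^+ n) z); first by rewrite expf_neq0.
    apply: differentiable_continuous; apply/derivable1_diffP.
    exact: exprn_derivable.
  - apply: (@near_eq_derivable C C C (cst 0)); last exact: derivable_cst.
    by apply: filterS h0 => ? ->.
  - apply: (@derivableM C C); first exact: fd.
    apply: (@derivableV C C (fun t => t ^+ n)); first by rewrite expf_neq0.
    exact: exprn_derivable.
have h1 : `|32^-1 : C| <= 32^-1 by rewrite ger0_norm // invr_ge0.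
have := cauchy_rep_bound hr _ h1 (M := M).
rewrite /h normrM exprVn invrK normrX normr_nat; apply=> w ws.
have w1 := square_ge1 ws.
rewrite normrM normrV ?unitfE ?expf_neq0 ?square_neq0 // normrX.
apply: le_trans (fM w (square_lt ws)); rewrite ler_piMr //.
rewrite invf_le1 ?exprn_ege1 // exprn_gt0 //; exact: lt_le_trans w1.
Qed.

Lemma gholomorphic_identity D g x0 : open D -> connected D -> gholomorphic D g ->
  D x0 -> g x0 != 0 -> generically D (fun x => g x != 0).
Proof.
move=> Do Dc gh Dx0 gx0.
(* [Z] is open, and closed in [D] because vanishing spreads over a distance fixed by the limit
   point; so it is empty or all of [D]. *)
pose Z := [set x | D x /\ nbhs x (fun y => g y = 0)].
have nearD x : D x -> nbhs x D by move=> Dx; apply: open_nbhs_nbhs.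
have Z0 : Z = set0.
  apply: contrapT => /eqP /set0P Zn.
  suff ZD : Z = D by have : Z x0 by [rewrite ZD]; case=> _ /nbhs_singleton; apply/eqP.
  apply: Dc => //.
    exists (interior [set y | g y = 0]); first exact: open_interior.
    by apply/seteqP; split=> x [].
  exists (closure Z); first exact: closed_closure.
  apply/seteqP; split=> [x Zx|x [Dx Zx]].
    by split; [have [] := Zx | exact: subset_closure].
  split=> //; have [r r0 xr] := local_bound Do gh Dx.
  (* Below, v = 32 (u - y) puts u at parameter [32^-1], the point reached by [cauchy_zero_near]. For
     |t| < 3 the line stays within 3 * 64 s + s < 512 s = r of x. *)
  pose s : C := r / 512.
  have s0 : 0 < s by apply: divr_gt0; [exact: r0 | rewrite ltr0n].
  have [y [[Dy yZ]]] := Zx (ball x s) (nbhsx_ballx x s s0).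
  rewrite -ball_normE /= distrC => yx.
  apply/nbhs_ballP; exists s => // u; rewrite -ball_normE /= distrC => ux.
  pose v := 32 *: (u - y).
  have vl : `|v| < 64 * s.
    rewrite /v normrZ normr_nat.
    have -> : u - y = (u - x) - (y - x) by rewrite opprB addrA subrK.
    have -> : 64 * s = 32 * (s + s) by ring.
    rewrite ltr_pM2l //; exact: le_lt_trans (ler_normB _ _) (ltrD ux yx).
  have lin (t : C) : `|t| < 3 -> `|t *: v + y - x| < r.
    move=> t3; rewrite -addrA; apply: le_lt_trans (ler_normD _ _) _.
    have -> : r = 511 * s + s by rewrite /s; field.
    apply: ltrD => //; rewrite normrZ.
    apply: (@le_lt_trans _ _ (3 * `|v|)); first by apply: ler_wpM2r => //; exact: ltW.
    apply: (@lt_le_trans _ _ (3 * (64 * s))); first by rewrite ltr_pM2l.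
    by rewrite mulrA -natrM ler_wpM2r ?(ltW s0) // ler_nat.
  pose f (t : C) : C := g (t *: v + y).
  have := @cauchy_zero_near f (`|g x| + 1).
  have -> : f 32^-1 = g u by rewrite /f /v scalerA mulVf ?scale1r ?subrK.
  apply=> [z z3|z z3|z z3|].
  - by apply: continuous_line; have [] := gh _ (xr _ (lin z z3)).1.
  - have [_ /(_ v) /derivableP /is_derive_line gd] := gh _ (xr _ (lin z z3)).1.
    exact: ex_derive.
  - exact: (xr _ (lin z z3)).2.
  - have lc : {for 0, continuous (fun t : C => t *: v + y)}.
      apply: (@continuousD C V C); last exact: cst_continuous.
      by apply: (@continuousZl C V C); exact: cvg_id.
    have yZ0 : nbhs (0 *: v + y) (fun y => g y = 0) by rewrite scale0r add0r.
    exact: lc _ yZ0.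
exists (D `&` [set x | g x != 0]); split.
- rewrite openE => x [Dx gx]; have [gc _] := gh x Dx.
  apply: filterI; first exact: nearD.
  have gx1 : 0 < `|g x| by rewrite normr_gt0.
  have [d d0 dP] := (continuous_dist g x).1 gc _ gx1.
  apply/nbhs_ballP; exists (rC d); first by rewrite /= -(rmorph0 rC) rC_lt.
  move=> y; rewrite -ball_normE /= distrC => /dP; apply: contraTneq => ->.
  by rewrite sub0r normrN ltxx.
- by move=> x [].
- move=> x Dx B Bx; apply: contrapT => N.
  have : Z x; last by rewrite Z0.
  split=> //; apply: filterS (filterI Bx (nearD x Dx)) => y [By Dy].
  by apply: contrapT => /eqP gy; apply: N; exists y.
- by move=> x [].
Qed.
End SeveralVariables.

(** * Matrices of monomials *)

Section MonomialMatrices.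
Variable F : fieldType.

Definition mono n (a : 'I_n -> F) (m : 'I_n -> nat) : F := \prod_(l < n) a l ^+ m l.

Definition mono_mx n d (p : 'I_d -> 'I_n -> F) (h : nat) : 'M[F]_(c n h, d) :=
  \matrix_(r < c n h, i < d) mono (p i) (fun l => tnth (multi_index r) l).

(* Independence of the images of the points [p i] under the Veronese map of degree [h]. *)
Definition veronese_free n (T : finType) (p : T -> 'I_n -> F) (h : nat) : Prop :=
  forall v : T -> F,
  (forall m : 'I_n -> nat, (\sum_l m l)%N = h -> \sum_i v i * mono (p i) m = 0) ->
  forall i, v i = 0.

Lemma monoD n (a : 'I_n -> F) (m m' : 'I_n -> nat) :
  mono a (fun l => m l + m' l)%N = mono a m * mono a m'.
Proof. by rewrite /mono -big_split; apply: eq_bigr => l _; rewrite exprD. Qed.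

Lemma mono_eq0 n (a : 'I_n -> F) (m : 'I_n -> nat) l :
  a l = 0 -> (0 < m l)%N -> mono a m = 0.
Proof. by move=> al ml; rewrite /mono (bigD1 l) //= al expr0n gtn_eqF // mul0r. Qed.

Lemma sum_multi_index n h (r : 'I_(c n h)) :
  (\sum_(l < n) tnth (multi_index r) l)%N = h.
Proof.
have := enum_valP (cast_ord (esym (card_multi_index n h)) r).
by rewrite inE big_tuple => /eqP.
Qed.

Lemma multi_index_surj n h (m : 'I_n -> nat) : (\sum_l m l)%N = h ->
  exists r : 'I_(c n h), forall l, tnth (multi_index r) l = m l :> nat.
Proof.
move=> mh.
have mlt l : (m l < h.+1)%N by rewrite ltnS -mh (bigD1 l) //= leq_addr.
pose t := [tuple Ordinal (mlt l) | l < n].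
have tP : t \in [set L : n.-tuple 'I_h.+1 | \sum_(l <- L) (l : nat) == h]%SET%N.
  rewrite inE big_tuple -[X in _ == X]mh; apply/eqP.
  by apply: eq_bigr => l _; rewrite tnth_mktuple.
exists (cast_ord (card_multi_index n h) (enum_rank_in tP t)) => l.
by rewrite /multi_index cast_ordK enum_rankK_in // tnth_mktuple.
Qed.

Lemma multi_index_inj n h (r r' : 'I_(c n h)) :
  (forall l, tnth (multi_index r) l = tnth (multi_index r') l :> nat) -> r = r'.
Proof.
move=> rr; have : multi_index r = multi_index r'.
  by apply: eq_from_tnth => l; apply: val_inj; exact: rr.
by move=> /enum_val_inj /cast_ord_inj.
Qed.

Lemma mono_mx_relation n d (p : 'I_d -> 'I_n -> F) h (v : 'I_d -> F) :
  mono_mx p h *m (\col_i v i) = 0 <->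
  forall m : 'I_n -> nat, (\sum_l m l)%N = h -> \sum_i v i * mono (p i) m = 0.
Proof.
split=> [Mv m mh|H].
  have [r rm] := multi_index_surj mh.
  have := congr1 (fun A : 'cV_(c n h) => A r 0) Mv; rewrite !mxE => E; rewrite -[RHS]E.
  apply: eq_bigr => i _; rewrite !mxE mulrC; congr (_ * _).
  by apply: eq_bigr => l _; rewrite rm.
apply/matrixP => r j; rewrite !mxE -[RHS](H (fun l => tnth (multi_index r) l)).
  by apply: eq_bigr => i _; rewrite !mxE mulrC.
exact: sum_multi_index.
Qed.

Lemma rank_mono_mx n d (p : 'I_d -> 'I_n -> F) h :
  \rank (mono_mx p h) = d <-> veronese_free p h.
Proof.
split=> [rd v vm i|pf].
  have Mv := (mono_mx_relation p h v).2 vm.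
  have : row_free (mono_mx p h)^T by rewrite -row_leq_rank mxrank_tr rd.
  move=> /row_free_inj /(_ (\col_i v i)^T 0); rewrite mul0mx -trmx_mul Mv trmx0.
  move=> /(_ erefl) /(congr1 (fun A : 'rV_d => A 0 i)); rewrite !mxE.
  by [].
apply/eqP; rewrite -mxrank_tr; change (row_free (mono_mx p h)^T).
apply: inj_row_free => v vM; apply/rowP => i; rewrite mxE.
apply: (pf (v 0)); apply/mono_mx_relation.
have -> : \col_i v 0 i = v^T by apply/matrixP => k j; rewrite !mxE ord1.
by rewrite -[mono_mx p h]trmxK -trmx_mul vM trmx0.
Qed.

Lemma unit_mono_mx n k (p : 'I_(c n k) -> 'I_n -> F) :
  (\det (mono_mx p k) != 0) <-> veronese_free p k.
Proof.
rewrite -rank_mono_mx -unitfE -unitmxE -row_free_unit.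
by split=> [/eqP|/eqP].
Qed.

Lemma veronese_free_le n (T : finType) (p : T -> 'I_n -> F) k h :
  (0 < k)%N -> (k <= h)%N -> veronese_free p k -> veronese_free p h.
Proof.
move=> k0 kh pf v vm i.
have vl l : v i * p i l ^+ (h - k) = 0.
  apply: (pf (fun i => v i * p i l ^+ (h - k))) => m mk.
  have := vm (fun l' => (l' == l) * (h - k) + m l')%N.
  rewrite big_split /= mk (bigD1 l) //= eqxx mul1n big1 => [|l' /negbTE -> //].
  rewrite addn0 subnK // => /(_ erefl) E.
  rewrite -[RHS]E; apply: eq_bigr => j _.
  rewrite monoD mulrA; congr (_ * _ * _).
  rewrite /mono (bigD1 l) //= eqxx mul1n big1 ?mulr1 //.
  by move=> l' /negbTE ->; rewrite expr0.
have [//|vi] := eqVneq (v i) 0.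
have pi l : (0 < h - k)%N -> p i l = 0.
  move=> hk; have /eqP := vl l; rewrite mulf_eq0 (negbTE vi) expf_eq0 hk.
  by move=> /eqP.
have [hk|kh'] := posnP (h - k).
  have hE : h = k by apply/eqP; rewrite eqn_leq kh -subn_eq0 hk.
  by rewrite hE in vm; exact: pf.
(* All the gradients of index [i] vanish, so the relation [delta_i] holds in degree [k]. *)
have := pf (fun j => (j == i)%:R) _ i; rewrite eqxx => H.
exfalso; suff /eqP : (1 : F) = 0 by rewrite oner_eq0.
apply: H => m mk.
rewrite (bigD1 i) //= eqxx mul1r big1 ?addr0 => [|j /negbTE -> ]; last by rewrite mul0r.
have [l ml] : exists l, (0 < m l)%N.
  apply/existsP; rewrite -[X in is_true X]negbK negb_exists; apply/negP => /forallP N.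
  by move: k0; rewrite -mk big1 // => l _; apply/eqP; rewrite -leqn0 leqNgt N.
exact: mono_eq0 (pi l kh') ml.
Qed.

Lemma row_free_mono_mx n k h (p : 'I_(c n k) -> 'I_n -> F) :
  (0 < n)%N -> (h <= k)%N -> veronese_free p k -> row_free (mono_mx p h).
Proof.
case: n p => // n p _ hk /unit_mono_mx Mu.
have {}Mu : mono_mx p k \in unitmx by rewrite unitmxE unitfE.
pose sh (r : 'I_(c n.+1 h)) (l : 'I_n.+1) := (tnth (multi_index r) l + (l == ord0) * (k - h))%N.
have shk r : (\sum_l sh r l)%N = k.
  rewrite big_split /= sum_multi_index (bigD1 ord0) //= mul1n big1 => [|l /negbTE -> //].
  by rewrite addn0 subnKC.
have [f fP] := choice (fun r => multi_index_surj (shk r)).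
have finj : injective f.
  move=> r r' rr; apply: multi_index_inj => l; apply/eqP.
  rewrite -(eqn_add2r ((l == ord0) * (k - h))).
  by have := fP r l; rewrite rr fP => /eqP; rewrite eq_sym.
apply: inj_row_free => u uM.
have : u *m rowsub f (mono_mx p k) = 0.
  apply/rowP => i; rewrite !mxE.
  have := congr1 (fun A : 'rV_ _ => A 0 i * p i ord0 ^+ (k - h)) uM.
  rewrite !mxE mul0r mulr_suml.
  move=> E; rewrite -[RHS]E; apply: eq_bigr => r _; rewrite !mxE -mulrA; congr (_ * _).
  rewrite /mono (eq_bigr (fun l => p i l ^+ sh r l)) => [|l _]; last by rewrite fP.
  rewrite -/(mono (p i) (sh r)) monoD; congr (_ * _).
  rewrite /mono (bigD1 ord0) //= mul1n big1 ?mulr1 //.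
  by move=> l /negbTE ->; rewrite expr0.
(* Multiplying by [rowsub f 1%:M] moves the coefficients of [u] to the positions [f r]. The full
   matrix cancels, and injectivity of [f] recovers [u]. *)
rewrite -[mono_mx p k]mul1mx -mul_rowsub_mx mulmxA => /(congr1 (mulmx^~ (invmx (mono_mx p k)))).
rewrite mul0mx mulmxK // => uf; apply/rowP => r; rewrite [RHS]mxE.
have := congr1 (fun A : 'rV_ _ => A 0 (f r)) uf; rewrite !mxE (bigD1 r) //= !mxE eqxx mulr1.
rewrite big1 ?addr0 // => r' rr; rewrite !mxE; case: eqP => [/finj E|_]; last by rewrite mulr0.
by rewrite E eqxx in rr.
Qed.

Lemma rank_mono_mx_max n k (p : 'I_(c n k) -> 'I_n -> F) h :
  (0 < n)%N -> (0 < k)%N -> veronese_free p k ->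
  \rank (mono_mx p h) = minn (c n k) (c n h).
Proof.
move=> n0 k0 pf; have [hk|kh] := leqP h k.
  have /eqP rE := row_free_mono_mx n0 hk pf.
  by rewrite rE (minn_idPr _) // -rE rank_leq_col.
have rE := (rank_mono_mx p h).2 (veronese_free_le k0 (ltnW kh) pf).
by rewrite {1}rE (minn_idPl _) // -{1}rE rank_leq_row.
Qed.

Lemma veronese_free_reindex n (T T' : finType) (s : T' -> T) (p : T -> 'I_n -> F) h :
  bijective s -> veronese_free p h <-> veronese_free (p \o s) h.
Proof.
move=> [s' sK s'K]; split=> pf v vm i.
  rewrite -(sK i); apply: (pf (v \o s')) => m mh.
  rewrite -[RHS](vm m mh) (reindex s) /=; last by exists s' => ? _.
  by apply: eq_bigr => j _; rewrite sK.
rewrite -(s'K i); apply: (pf (v \o s)) => m mh.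
by rewrite -[RHS](vm m mh) [RHS](reindex s) //=; exists s' => ? _.
Qed.

(* Proportional points would give proportional columns. *)
Lemma veronese_free_indep n (T : finType) (p : T -> 'I_n -> F) k (i j : T) (a b : F) :
  (0 < k)%N -> veronese_free p k -> i != j ->
  (forall l, a * p i l + b * p j l = 0) -> a = 0 /\ b = 0.
Proof.
move=> k0 pf ij.
wlog suff H : i j a b ij / (forall l, a * p i l + b * p j l = 0) -> b = 0.
  move=> ab; split; last exact: H ij ab.
  by apply: (H j i b a); rewrite 1?eq_sym // => l; rewrite addrC.
move=> ab; apply/eqP/negP => /negP b0.
have pj l : p j l = (- a / b) * p i l.
  apply: (mulfI b0); have -> : b * (- a / b * p i l) = - (a * p i l) by field.
  by apply/eqP; rewrite -addr_eq0 addrC ab.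
have := pf (fun s => (s == j)%:R - (s == i)%:R * (- a / b) ^+ k) _ j.
rewrite eqxx eq_sym (negbTE ij) mul0r subr0 => H.
exfalso; suff /eqP : (1 : F) = 0 by rewrite oner_eq0.
apply: H => m mk.
rewrite (bigD1 i) //= (bigD1 j) 1?eq_sym //= big1 => [|s /andP[/negbTE -> /negbTE ->]]; last first.
  by rewrite mul0r subrr mul0r.
rewrite !eqxx [j == i]eq_sym (negbTE ij) mul0r sub0r subr0 addr0 !mul1r.
have -> : mono (p j) m = (- a / b) ^+ k * mono (p i) m.
  rewrite -mk -prodrXr -big_split; apply: eq_bigr => l _.
  by rewrite pj exprMn.
by rewrite mulNr addNr.
Qed.
End MonomialMatrices.
Lemma big_inj_supp (A : Type) (idx : A) (op : Monoid.com_law idx) (T T' : finType)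
    (f : T' -> T) (G : T -> A) :
  injective f -> (forall t, (forall b, t != f b) -> G t = idx) ->
  \big[op/idx]_t G t = \big[op/idx]_b G (f b).
Proof.
move=> fi G0; rewrite (bigID [pred t | t \in codom f]) /= [X in op _ X]big1 ?Monoid.mulm1.
  have cu : uniq (codom f) by rewrite map_inj_uniq // enum_uniq.
  by rewrite -(big_uniq _ cu) big_image.
move=> t /codomP N; apply: G0 => b; apply/eqP => tE; apply: N.
by exists b.
Qed.

(** * Triangular structure of the matrix of a superposition *)

Section SuperIndex.
Variables (k0 n : nat).

Definition indices (s : super_index k0 n) : (tag s).+1.-tuple 'I_n :=
  val (tagged s).1.

Definition super_at (k : 'I_k0) (I : {I : k.+1.-tuple 'I_n | sorted ltn (map val I)})
    (b : 'I_(c k.+1 (k0 - k.+1))) : super_index k0 n :=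
  existT _ k (I, b).

Lemma super_at_inj k I : injective (@super_at k I).
Proof. by move=> b b' E; have /(congr1 snd) := eq_from_Tagged E. Qed.

Lemma sorted_indices_uniq k (I : k.-tuple 'I_n) : sorted ltn (map val I) -> uniq I.
Proof.
by move=> /(sorted_uniq ltn_trans ltnn); rewrite map_inj_uniq //; exact: val_inj.
Qed.

(** Cardinality forces the two index sets to coincide, and an increasing tuple is determined by its
    elements. *)
Lemma super_at_subset (k : 'I_k0) (I : {I : k.+1.-tuple 'I_n | sorted ltn (map val I)})
    (s : super_index k0 n) :
  (tag s <= k)%N -> {subset val I <= indices s} -> exists b, s = super_at I b.
Proof.
case: s => k' [[I' I's] b] /= k'k; rewrite /indices /= => II'.
have Iu := sorted_indices_uniq (valP I).
have I'u := sorted_indices_uniq I's.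
have sz : (size I' <= size (val I))%N by rewrite !size_tuple ltnS.
have [kk mem] := uniq_min_size Iu II' sz.
have kE : k' = k by apply: val_inj; apply/eqP; rewrite -eqSS -[X in X == _](size_tuple I')
  -[X in _ == X](size_tuple (val I)) kk.
subst k'; exists b; rewrite /super_at.
suff -> : exist _ I' I's = I :> {I : k.+1.-tuple 'I_n | sorted ltn (map val I)} by [].
apply: val_inj => /=; apply: val_inj => /=; apply: (inj_map val_inj).
apply: (irr_sorted_eq ltn_trans ltnn I's (valP I)) => x.
by apply/mapP/mapP => -[y yI ->]; exists y; rewrite // ?mem // -mem.
Qed.

Variable F : fieldType.
Variable p : super_index k0 n -> 'I_n -> F.
Hypothesis p0 : forall s l, l \notin indices s -> p s l = 0.

(* Evaluating a relation on the multi-indices of support [I] only sees the first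
   integrals attached to supersets of [I]: descending induction on the size of [I]. *)
Lemma veronese_free_super :
  (forall s j, p s (tnth (indices s) j) != 0) ->
  (forall k I, veronese_free (fun b j => p (@super_at k I b) (tnth (val I) j)) (k0 - k.+1)) ->
  veronese_free p k0.
Proof.
move=> pn0 blk v vm s; have [N] := ubnP (k0 - tag s)%N.
elim: N s => [//|N IH] [k [I b]]; rewrite ltnS /= => kN.
pose P b := \prod_j p (@super_at k I b) (tnth (val I) j).
have Pn0 : P b != 0 by apply/prodf_neq0 => j _; exact: (pn0 (@super_at k I b) j).
suff vb : v (@super_at k I b) * P b = 0.
  by move/eqP: vb; rewrite mulf_eq0 (negbTE Pn0) orbF => /eqP.
apply: (blk k I (fun b => v (@super_at k I b) * P b)) => m' m'k.
(* The multi-index [m'] of the block, raised by 1 in each variable of [I]: its support is exactly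
   [I], its degree is [k0], and the extra factor in the monomial is [P b]. *)
pose m l := (\sum_(j | tnth (val I) j == l) (m' j).+1)%N.
have mk : (\sum_l m l)%N = k0.
  transitivity (\sum_j (m' j).+1)%N.
    by rewrite [RHS](partition_big (tnth (val I)) xpredT).
  under eq_bigr do rewrite -add1n.
  by rewrite big_split /= m'k sum1_card card_ord subnKC.
rewrite -[RHS](vm m mk) (big_inj_supp _ (@super_at_inj k I)) => [|t tn].
  apply: eq_bigr => b' _; rewrite -mulrA; congr (_ * _).
  rewrite /mono; under [RHS]eq_bigr do rewrite -prodrXr.
  rewrite [RHS](eq_bigr (fun l => \prod_(j | tnth (val I) j == l)
     p (super_at I b') (tnth (val I) j) ^+ (m' j).+1)) => [|l _]; last first.
    by apply: eq_bigr => j /eqP ->.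
  transitivity (\prod_j p (super_at I b') (tnth (val I) j) ^+ (m' j).+1); last first.
    by rewrite (partition_big (tnth (val I)) xpredT).
  rewrite -big_split; apply: eq_bigr => j _.
  by rewrite exprS.
(* Larger index sets have zero coefficient by induction. Any other set different from [I] misses an
   element of [I], where the exponent is positive. *)
have [kt|tk] := ltnP k (tag t).
  by rewrite IH ?mul0r //; apply: leq_trans kN; rewrite ltn_sub2l // (leq_trans kt) // ltnW.
have [j jt] : exists j, tnth (val I) j \notin indices t.
  apply/existsP; rewrite -[X in is_true X]negbK negb_exists; apply/negP => /forallP N'.
  have [|b' tb'] := @super_at_subset k I t tk; last by have := tn b'; rewrite tb' eqxx.
  by move=> l /tnthP[j ->]; have := N' j; rewrite negbK.
rewrite (mono_eq0 (p0 jt)) ?mulr0 //.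
by rewrite /m (bigD1 j) //= addSn.
Qed.
End SuperIndex.

Section SuperRestriction.
Variables (k0 n k : nat) (F : fieldType).
Hypothesis kn : (k <= n)%N.

Lemma sorted_widen (l : nat) (I : l.-tuple 'I_k) : sorted ltn (map val I) ->
  sorted ltn (map val [tuple of map (widen_ord kn) I]).
Proof. by rewrite /= -map_comp. Qed.

Definition widen_super (s : super_index k0 k) : super_index k0 n :=
  existT _ (tag s) (exist _ [tuple of map (widen_ord kn) (val (tagged s).1)]
    (sorted_widen (valP (tagged s).1)), (tagged s).2).

Lemma widen_super_inj : injective widen_super.
Proof.
move=> [l [[I Is] b]] [l' [[I' I's] b']] E.
have ll : l = l' by have := congr1 (@tag _ _) E.
subst l'; have E' := eq_from_Tagged E.
have wi : injective (widen_ord kn) by move=> i j /(congr1 val) /= ij; apply: val_inj.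
have bb : b = b' := congr1 snd E'.
have /(inj_map wi) II := congr1 (fun x => val (val x.1)) E'.
rewrite bb.
suff -> : exist _ I Is = exist _ I' I's :> {I : l.+1.-tuple 'I_k | sorted ltn (map val I)} by [].
by apply: val_inj => /=; apply: val_inj.
Qed.

Variable p : super_index k0 n -> 'I_n -> F.
Hypothesis p0 : forall s l, l \notin indices s -> p s l = 0.

(** A relation on the first k variables, extended by zero, stays a relation: a monomial involving a
    further variable vanishes on every widened column. *)
Lemma veronese_free_widen : veronese_free p k0 ->
  veronese_free (fun s l => p (widen_super s) (widen_ord kn l)) k0.
Proof.
move=> pf v vm s.
have wi : injective (widen_ord kn) by move=> i j /(congr1 val) /= ij; apply: val_inj.
(* The fibre sum is the extension of [v] by zero, since [widen_super] is injective. *)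
pose w t := \sum_(s | widen_super s == t) v s.
have <- : w (widen_super s) = v s.
  rewrite /w (eq_bigl (pred1 s)) ?big_pred1_eq // => s'.
  by apply/eqP/eqP => [/widen_super_inj|->].
apply: pf => m mk; rewrite /w.
have -> : \sum_t (\sum_(s | widen_super s == t) v s) * mono (p t) m =
    \sum_s v s * mono (p (widen_super s)) m.
  rewrite [RHS](partition_big widen_super xpredT) //=; apply: eq_bigr => t _.
  by rewrite mulr_suml; apply: eq_bigr => s' /eqP ->.
have [/existsP[l /andP[lk ml]]|/existsPn N] := boolP [exists l : 'I_n, (k <= l)%N && (0 < m l)%N].
  apply: big1 => s' _; rewrite (@mono_eq0 _ _ _ _ l) ?mulr0 //; apply: p0.
  rewrite /indices /=; apply/mapP => -[l' _ lE]; move: lk.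
  by rewrite lE /= leqNgt ltn_ord.
have out (A : Type) (idx : A) (op : Monoid.com_law idx) (G : 'I_n -> A) :
    (forall l, m l = 0%N -> G l = idx) ->
    \big[op/idx]_l G l = \big[op/idx]_l G (widen_ord kn l).
  move=> G0; apply: big_inj_supp wi _ => l ln; apply: G0; apply/eqP.
  have := N l; rewrite negb_and -ltnNge -eqn0Ngt => /orP[lk|//].
  by have := ln (Ordinal lk); case/eqP; apply: val_inj.
rewrite -[RHS](vm (fun l => m (widen_ord kn l))).
  apply: eq_bigr => s' _; congr (_ * _); rewrite /mono out // => l ml.
  by rewrite ml expr0.
by rewrite -[RHS]mk [RHS]out.
Qed.
End SuperRestriction.

Section TopBlock.
Variables (k0 : nat) (k : 'I_k0) (F : fieldType).

Lemma sorted_ord_tuple n : sorted ltn (map val (ord_tuple n)).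
Proof. by rewrite val_ord_tuple val_enum_ord iota_ltn_sorted. Qed.

Definition full_indices : {I : k.+1.-tuple 'I_k.+1 | sorted ltn (map val I)} :=
  exist _ (ord_tuple k.+1) (sorted_ord_tuple k.+1).

Variable p : super_index k0 k.+1 -> 'I_k.+1 -> F.
Hypothesis p0 : forall s l, l \notin indices s -> p s l = 0.

(** The argument runs on rows: those with all exponents positive vanish outside the block of the
    full index set, so a row relation of the block extends to the whole matrix. A column relation
    need not, because these columns also meet the other rows. *)
Lemma veronese_free_top : (2 <= k0)%N -> veronese_free p k0 ->
  veronese_free (fun b l => p (@super_at k0 k.+1 k full_indices b) l) (k0 - k.+1).
Proof.
move=> hk0 pf.
pose e (i : 'I_(c k.+1 k0)) := enum_val (cast_ord (esym (card_super_index k.+1 hk0)) i).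
have eb : bijective e.
  by apply: bij_comp (enum_val_bij _) _; exact: (Bijective (cast_ordK _) (cast_ordKV _)).
have {}pf := (veronese_free_reindex _ _ eb).1 pf.
apply/unit_mono_mx; rewrite -unitfE -unitmxE -row_free_unit.
have Mu : row_free (mono_mx (p \o e) k0).
  by rewrite row_free_unit unitmxE unitfE; apply/unit_mono_mx.
pose sh (r : 'I_(c k.+1 (k0 - k.+1))) l := (tnth (multi_index r) l).+1.
have shk r : (\sum_l sh r l)%N = k0.
  rewrite /sh; under eq_bigr do rewrite -add1n.
  by rewrite big_split /= sum_multi_index sum1_card card_ord subnKC.
have [f fP] := choice (fun r => multi_index_surj (shk r)).
have finj : injective f.
  move=> r r' rr; apply: multi_index_inj => l; apply: succn_inj.
  by have := fP r l; rewrite rr fP => E; exact: esym E.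
apply: inj_row_free => u uB.
have uM : u *m rowsub f (mono_mx (p \o e) k0) = 0.
  apply/rowP => i; rewrite !mxE.
  have [[l li]|[b eE]] : (exists l, l \notin indices (e i)) \/
      exists b, e i = super_at full_indices b.
    have [/existsP|/existsPn N] := boolP [exists l, l \notin indices (e i)]; first by left.
    right; apply: super_at_subset => [|l _]; last by have := N l; rewrite negbK.
    rewrite -ltnS -[X in (X <= _)%N](size_tuple (indices (e i))).
    have /card_uniqP <- := sorted_indices_uniq (valP (tagged (e i)).1).
    by rewrite -[X in (_ <= X)%N](card_ord k.+1) max_card.
  - apply: big1 => r _; rewrite !mxE /= (@mono_eq0 _ _ _ _ l) ?mulr0 //; first exact: p0.
    by rewrite fP.
  - have := congr1 (fun A : 'rV_ _ => (\prod_l p (super_at full_indices b) l) * A 0 b) uB.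
    rewrite !mxE mulr0 mulr_sumr => E; rewrite -[RHS]E.
    apply: eq_bigr => r _; rewrite !mxE /= eE mulrCA; congr (_ * _).
    rewrite /mono -big_split; apply: eq_bigr => l _.
    by rewrite fP exprS.
have uf : u *m rowsub f 1%:M = 0.
  apply: (row_free_inj Mu); rewrite mul0mx -mulmxA mul_rowsub_mx mul1mx; exact: uM.
apply/rowP => r; rewrite [RHS]mxE.
have := congr1 (fun A : 'rV_ _ => A 0 (f r)) uf; rewrite !mxE (bigD1 r) //= !mxE eqxx mulr1.
rewrite big1 ?addr0 // => r' rr; rewrite !mxE; case: eqP => [/finj E|_]; last by rewrite mulr0.
by rewrite E eqxx in rr.
Qed.
End TopBlock.

(** * Webs at generic points *)

Section Generic.
Variable T : topologicalType.
Implicit Types (D W : set T) (P Q : T -> Prop).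

Lemma generically_and D P Q : generically D P -> generically D Q ->
  generically D (fun x => P x /\ Q x).
Proof.
move=> [A [Ao AD DA AP]] [B [Bo BD DB BQ]].
exists (A `&` B); split; first exact: openI.
- by move=> x [/AD].
- move=> x Dx U Ux; have Un : nbhs x (interior U) by exact: nbhs_interior.
  have [y [Ay Uy]] := DA x Dx _ Un.
  have [z [Bz [Uz Az]]] := DB y (AD y Ay) (interior U `&` A)
    (open_nbhs_nbhs (conj (openI (@open_interior _ _) Ao) (conj Uy Ay))).
  by exists z; split=> //; exact: interior_subset.
- by move=> x [/AP Px /BQ Qx].
Qed.

Lemma generically_forall (I : finType) D (P : I -> T -> Prop) : open D ->
  (forall i, generically D (P i)) -> generically D (fun x => forall i, P i x).
Proof.
move=> Do PD.
suff [A [Ao AD DA AP]] : generically D (fun x => forall i, i \in enum I -> P i x).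
  by exists A; split=> // x Ax i; apply: AP => //; rewrite mem_enum.
elim: (enum I) => [|i s IH].
  by exists D; split=> //; exact: subset_closure.
have [A [Ao AD DA AP]] := generically_and (PD i) IH.
exists A; split=> // x /AP[Pi Ps] j; rewrite inE => /orP[/eqP-> //|]; exact: Ps.
Qed.
End Generic.

Section Holomorphic.
Variables (R : realType) (V : normedModType (Cplx R)) (D : set V).
Local Notation C := (Cplx R).

Lemma gholomorphic_cst (a : C) : gholomorphic D (fun=> a).
Proof. by move=> x _; split=> [|v]; [exact: cst_continuous | exact: derivable_cst]. Qed.

Lemma gholomorphicD (f g : V -> C) : gholomorphic D f -> gholomorphic D g ->
  gholomorphic D (fun x => f x + g x).
Proof.
move=> fh gh x Dx; have [fc fd] := fh x Dx; have [gc gd] := gh x Dx.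
split=> [|v]; first by apply: (@continuousD C C V); [exact: fc | exact: gc].
by apply: (@derivableD C V C f g x v); [exact: fd | exact: gd].
Qed.

Lemma gholomorphicM (f g : V -> C) : gholomorphic D f -> gholomorphic D g ->
  gholomorphic D (fun x => f x * g x).
Proof.
move=> fh gh x Dx; have [fc fd] := fh x Dx; have [gc gd] := gh x Dx.
split=> [|v]; first by apply: (@continuousM C V); [exact: fc | exact: gc].
by apply: (@derivableM C V f g x v); [exact: fd | exact: gd].
Qed.

Lemma gholomorphicX (f : V -> C) m : gholomorphic D f -> gholomorphic D (fun x => f x ^+ m).
Proof.
move=> fh; elim: m => [|m IH]; first exact: gholomorphic_cst.
have -> : (fun x => f x ^+ m.+1) = (fun x => f x * f x ^+ m).
  by apply/funext => x; rewrite exprS.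
exact: (gholomorphicM fh IH).
Qed.

Lemma gholomorphic_sum (I : Type) (r : seq I) (f : I -> V -> C) :
  (forall i, gholomorphic D (f i)) -> gholomorphic D (fun x => \sum_(i <- r) f i x).
Proof.
move=> fh; elim: r => [|i r IH].
  by under eq_fun do rewrite big_nil; exact: gholomorphic_cst.
by under eq_fun do rewrite big_cons; exact: (gholomorphicD (fh i) IH).
Qed.

Lemma gholomorphic_prod (I : Type) (r : seq I) (f : I -> V -> C) :
  (forall i, gholomorphic D (f i)) -> gholomorphic D (fun x => \prod_(i <- r) f i x).
Proof.
move=> fh; elim: r => [|i r IH].
  by under eq_fun do rewrite big_nil; exact: gholomorphic_cst.
by under eq_fun do rewrite big_cons; exact: (gholomorphicM (fh i) IH).
Qed.

Lemma gholomorphic_det d (M : V -> 'M[C]_d) :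
  (forall i j, gholomorphic D (fun x => M x i j)) -> gholomorphic D (fun x => \det (M x)).
Proof.
move=> Mh; rewrite /determinant; apply: gholomorphic_sum => s.
apply: (gholomorphicM (gholomorphic_cst _)).
by apply: gholomorphic_prod => i; exact: Mh.
Qed.
End Holomorphic.

Section Projection.
Variables (R : realType) (n k : nat) (I : k.-tuple 'I_n).
Hypothesis Iu : uniq I.
Local Notation C := (Cplx R).

Lemma derive_proj (f : 'rV[C]_k -> C) (x v : 'rV[C]_n) :
  'D_v (f \o @Defs.proj R n k I) x = 'D_(Defs.proj I v) f (Defs.proj I x).
Proof.
have E (h : C) : Defs.proj I (h *: v + x) = h *: Defs.proj I v + Defs.proj I x.
  by apply/rowP => j; rewrite !mxE.
rewrite /derive.
have -> : (fun h : C => h^-1 *: ((f \o @Defs.proj R n k I) (h *: v + x) -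
    (f \o @Defs.proj R n k I) x)) =
    (fun h : C => h^-1 *: (f (h *: Defs.proj I v + Defs.proj I x) - f (Defs.proj I x))).
  by apply/funext => h /=; rewrite E.
by [].
Qed.

Lemma proj_delta (j : 'I_k) : @Defs.proj R n k I 'e_(tnth I j) = 'e_j.
Proof.
apply/rowP => i; rewrite !mxE !eqxx /=; congr (_%:R).
by rewrite (inj_eq (tuple_uniqP _ Iu)).
Qed.

Lemma proj_delta0 (l : 'I_n) : l \notin I -> @Defs.proj R n k I 'e_l = 0.
Proof.
move=> lI; apply/rowP => i; rewrite !mxE !eqxx /=; case: eqP => // il.
by rewrite -il mem_tnth in lI.
Qed.

Lemma continuous_proj : continuous (@Defs.proj R n k I).
Proof.
move=> x B /nbhs_ballP[e e0 eB]; apply/nbhs_ballP; exists e => // y xy.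
by apply: eB; split=> // i j; rewrite !mxE; exact: xy.2.
Qed.

(** A point near the projection of x lifts to a point near x by changing only the coordinates listed
    in [I]; this lift is [phi]. *)
Lemma generically_proj (U : set 'rV[C]_k) (W : set 'rV[C]_n) (P : 'rV[C]_k -> Prop) :
  open W -> W `<=` @Defs.proj R n k I @^-1` U -> generically U P ->
  generically W (fun x => P (Defs.proj I x)).
Proof.
move=> Wo WU [A [Ao AU UA AP]]; exists (W `&` @Defs.proj R n k I @^-1` A); split.
- apply: openI => //; apply: open_comp => // x _; exact: continuous_proj.
- by move=> x [].
- move=> x Wx B Bx.
  have /nbhs_ballP[e e0 eB] : nbhs x (B `&` W) by apply: filterI => //; exact: open_nbhs_nbhs.
  pose phi (w : 'rV[C]_k) : 'rV[C]_n :=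
    \row_l if [pick j | tnth I j == l] is Some j then w 0 j else x 0 l.
  have [w [Aw xw]] := UA _ (WU x Wx) (ball (Defs.proj I x) e) (nbhsx_ballx _ _ e0).
  have pw : Defs.proj I (phi w) = w.
    apply/rowP => j; rewrite !mxE; case: pickP => [i /eqP|/(_ j)]; last by rewrite eqxx.
    by move=> /(tuple_uniqP _ Iu) ->.
  have [Bw Ww] : (B `&` W) (phi w).
    apply: eB; split=> // i l; rewrite !mxE ord1.
    case: pickP => [j /eqP jl|_]; last exact: ballxx.
    by have := xw.2 0 j; rewrite mxE jl.
  by exists (phi w); split=> //; split=> //=; rewrite pw.
- by move=> x [_ /AP].
Qed.
End Projection.

Section Webs.
Variable R : realType.
Local Notation C := (Cplx R).

Definition gradient n (f : 'rV[C]_n -> C) (x : 'rV[C]_n) (l : 'I_n) : C := 'D_('e_l) f x.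

Lemma web_mxE n d (u : 'I_d -> 'rV[C]_n -> C) h x :
  web_mx u h x = mono_mx (fun i => gradient (u i) x) h.
Proof. by apply/matrixP => r i; rewrite !mxE. Qed.

Lemma gholomorphic_web_det n h D (u : 'I_(c n h) -> 'rV[C]_n -> C) :
  open D -> (forall i, holomorphic_on D (u i)) ->
  gholomorphic D (fun x => \det (web_mx u h x)).
Proof.
move=> Do uh; apply: gholomorphic_det => r i.
have -> : (fun x => web_mx u h x r i) =
    (fun x => \prod_l 'D_('e_l) (u i) x ^+ tnth (multi_index r) l).
  by apply/funext => x; rewrite mxE.
apply: gholomorphic_prod => l; apply: gholomorphicX; apply: gholomorphic_derive => // x Dx.
have ud := uh i x Dx.
by split=> [|v]; [exact: differentiable_continuous | exact: diff_derivable].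
Qed.

Lemma gradient_proj_tnth n k (I : k.-tuple 'I_n) (f : 'rV[C]_k -> C) x j : uniq I ->
  gradient (f \o @Defs.proj R n k I) x (tnth I j) = gradient f (Defs.proj I x) j.
Proof. by move=> Iu; rewrite /gradient derive_proj proj_delta. Qed.

Lemma gradient_proj_notin n k (I : k.-tuple 'I_n) (f : 'rV[C]_k -> C) x l : l \notin I ->
  gradient (f \o @Defs.proj R n k I) x l = 0.
Proof. by move=> lI; rewrite /gradient derive_proj proj_delta0 // derive0. Qed.

Lemma differentiable_proj n k (I : k.-tuple 'I_n) x : differentiable (@Defs.proj R n k I) x.
Proof.
pose P : 'M[C]_(n, k) := \matrix_(l, j) (l == tnth I j)%:R.
have E : @Defs.proj R n k I = mulmxr P.
  apply/funext => y; apply/rowP => j; rewrite !mxE (bigD1 (tnth I j)) //= mxE eqxx mulr1.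
  by rewrite big1 ?addr0 // => l /negbTE lj; rewrite mxE lj mulr0.
have Pc : continuous (mulmxr P : 'rV[C]_n -> 'rV[C]_k) by rewrite -E; exact: continuous_proj.
by rewrite E; apply: linear_differentiable => y; exact: Pc.
Qed.

(** Each T_k has a first integral, so quantifying over [super_index] reaches every increasing tuple
    of length at most [k0]. *)
Lemma c_gt0 k h : (0 < c k.+1 h)%N.
Proof. by rewrite /c addSn subn1 bin_gt0 leq_addl. Qed.

Section Superposition.
Variables (k0 : nat) (E : web_family R k0).
Hypothesis hk0 : (2 <= k0)%N.

Definition super_gradient n (x : 'rV[C]_n) (s : super_index k0 n) : 'I_n -> C :=
  gradient (super_fint E s) x.

Lemma super_gradient_notin n (x : 'rV[C]_n) s l : l \notin indices s ->
  super_gradient x s l = 0.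
Proof. exact: gradient_proj_notin. Qed.

Lemma super_gradient_tnth n (x : 'rV[C]_n) (k : 'I_k0)
    (I : {I : k.+1.-tuple 'I_n | sorted ltn (map val I)}) b j :
  super_gradient x (super_at I b) (tnth (val I) j) =
  gradient (fint E k.+1 b) (Defs.proj (val I) x) j.
Proof. exact: (gradient_proj_tnth _ _ _ (sorted_indices_uniq (valP I))). Qed.

Definition super_enum n (i : 'I_(c n k0)) : super_index k0 n :=
  enum_val (cast_ord (esym (card_super_index n hk0)) i).

Lemma super_enum_bij n : bijective (@super_enum n).
Proof.
by apply: bij_comp (enum_val_bij _) _; exact: (Bijective (cast_ordK _) (cast_ordKV _)).
Qed.

Lemma super_web_mxE n h (x : 'rV[C]_n) :
  web_mx (super_web E n hk0) h x = mono_mx (super_gradient x \o @super_enum n) h.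
Proof. by rewrite web_mxE. Qed.

Lemma unit_super_web_mx n (x : 'rV[C]_n) :
  (\det (web_mx (super_web E n hk0) k0 x) != 0) <-> veronese_free (super_gradient x) k0.
Proof.
rewrite super_web_mxE unit_mono_mx.
exact: iff_sym (veronese_free_reindex _ _ (@super_enum_bij n)).
Qed.

Lemma ordinary_super_web n (x : 'rV[C]_n) : (0 < n)%N ->
  veronese_free (super_gradient x) k0 -> ordinary_at (super_web E n hk0) x.
Proof.
move=> n0 /(veronese_free_reindex _ _ (@super_enum_bij n)) xf h _.
by rewrite super_web_mxE; exact: (rank_mono_mx_max h n0 (ltnW hk0) xf).
Qed.

Lemma unit_super_web_ordinary n (x : 'rV[C]_n) : ordinary_at (super_web E n hk0) x ->
  \det (web_mx (super_web E n hk0) k0 x) != 0.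
Proof.
move=> /(_ k0 (ltnW hk0)); rewrite minnn => rk.
by rewrite -unitfE -unitmxE -row_free_unit; apply/eqP.
Qed.

Hypothesis hE : balanced E.

Lemma gholomorphic_fint k b : (1 <= k <= k0)%N -> gholomorphic (dom E k) (fint E k b).
Proof.
move=> kk x Dx; have [_ _ [_ uh _ _] _] := hE.1 k kk; have ud := uh b x Dx.
by split=> [|v]; [exact: differentiable_continuous | exact: diff_derivable].
Qed.

Lemma generically_web k : (1 <= k <= k0)%N ->
  generically_invertible (dom E k) (web_mx (fint E k) (k0 - k)) ->
  generically (dom E k) (fun y => veronese_free (fun b => gradient (fint E k b) y) (k0 - k) /\
    forall bj : 'I_(c k (k0 - k)) * 'I_k, gradient (fint E k bj.1) y bj.2 != 0).
Proof.
move=> kk Hdet; have [_ Dc [Do _ _ _] Dn] := hE.1 k kk.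
apply: generically_and.
  have [A [Ao AD DA AP]] := Hdet; exists A; split=> // y /AP.
  by rewrite web_mxE unit_mono_mx.
apply: generically_forall => // -[b j] /=; have [x Dx xb] := Dn b j.
apply: (gholomorphic_identity Do Dc _ Dx xb).
by apply: gholomorphic_derive => //; exact: gholomorphic_fint.
Qed.

(* The conditions on independent differentials in [super_dom] are left out: they
   follow from the invertibility of the matrix of degree [k0]. *)
Definition proj_dom n : set 'rV[C]_n := [set x | forall s : super_index k0 n,
  dom E (tag s).+1 (Defs.proj (indices s) x)].

Lemma open_proj_dom n : open (@proj_dom n).
Proof.
rewrite openE => x xW.
apply: (@filter_forall 'rV[C]_n (super_index k0 n)
  (fun s (y : 'rV[C]_n) => dom E (tag s).+1 (Defs.proj (indices s) y)) (nbhs x)) => s.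
have [_ _ [Do _ _ _] _] := hE.1 (tag s).+1 (ltn_ord _).
exact: (continuous_proj (open_nbhs_nbhs (conj Do (xW s)))).
Qed.

Lemma super_dom_proj_dom n : super_dom E n `<=` @proj_dom n.
Proof. by move=> x [xW _] s; apply: xW; [exact: ltn_ord | exact: (valP (tagged s).1)]. Qed.

Lemma super_fint_differentiable n (s : super_index k0 n) x : @proj_dom n x ->
  differentiable (super_fint E s) x.
Proof.
move=> xW; have [_ _ [_ uh _ _] _] := hE.1 (tag s).+1 (ltn_ord _).
have ud := uh (tagged s).2 _ (xW s).
apply: (@differentiable_comp _ _ _ _ (@Defs.proj R n _ (indices s)) (fint E _ (tagged s).2)) => //.
exact: differentiable_proj.
Qed.

Lemma super_dom_veronese n x : @proj_dom n x -> veronese_free (super_gradient x) k0 ->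
  super_dom E n x.
Proof.
move=> xW xf; split=> [k I kk Is|s t st a b ab].
  case: k kk I Is => // k kk I Is.
  exact: xW (@super_at _ _ (Ordinal kk) (exist _ I Is) (Ordinal (c_gt0 k (k0 - k.+1)))).
apply: (veronese_free_indep (ltnW hk0) xf st) => l.
have dE r : 'd (super_fint E r) x 'e_l = super_gradient x r l.
  exact: esym (deriveE 'e_l (super_fint_differentiable r xW)).
by rewrite -(dE s) -(dE t); exact: ab 'e_l.
Qed.

Lemma generically_super n : 
  (forall k, (1 <= k <= k0)%N ->
     generically_invertible (dom E k) (web_mx (fint E k) (k0 - k))) ->
  generically (@proj_dom n) (fun x => veronese_free (super_gradient x) k0).
Proof.
move=> Hdet.
have [] : generically (@proj_dom n) (fun x => forall s : super_index k0 n,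
    veronese_free (fun b => gradient (fint E (tag s).+1 b) (Defs.proj (indices s) x))
      (k0 - (tag s).+1) /\
    forall bj : 'I_(c (tag s).+1 (k0 - (tag s).+1)) * 'I_(tag s).+1,
      gradient (fint E (tag s).+1 bj.1) (Defs.proj (indices s) x) bj.2 != 0).
  apply: generically_forall; first exact: open_proj_dom.
  move=> s; have sk : (1 <= (tag s).+1 <= k0)%N := ltn_ord (tag s).
  apply: (generically_proj (sorted_indices_uniq (valP (tagged s).1)) (@open_proj_dom n) _
    (generically_web sk (Hdet _ sk))).
  by move=> x xW; exact: xW s.
move=> A [Ao AD DA AP]; exists A; split=> // x /AP xP.
apply: veronese_free_super => [s l|[k [I b]] j|k I].
- exact: super_gradient_notin.
- rewrite super_gradient_tnth; exact: (xP (super_at I b)).2 (b, j).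
- have -> : (fun b j => super_gradient x (super_at I b) (tnth (val I) j)) =
      (fun b => gradient (fint E k.+1 b) (Defs.proj (val I) x)).
    by apply/funext => b; apply/funext => j; exact: super_gradient_tnth.
  exact: (xP (super_at I (Ordinal (c_gt0 k (k0 - k.+1))))).1.
Qed.

(** Keeping only the first k variables makes (1, ..., k) the full index set, so that its block
    becomes the extreme one of the triangle. *)
Lemma super_web_invertible_block n (x : 'rV[C]_n) k : (1 <= k <= k0)%N -> (k <= n)%N ->
  super_dom E n x -> veronese_free (super_gradient x) k0 ->
  exists2 y, dom E k y & \det (web_mx (fint E k) (k0 - k) y) != 0.
Proof.
case: k => // k kk kn [xW _] xf.
pose I := [tuple of map (widen_ord kn) (val (@full_indices k0 (Ordinal kk)))].
have Is : sorted ltn (map val I) by apply: sorted_widen; exact: sorted_ord_tuple.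
exists (Defs.proj I x); first exact: xW.
have := veronese_free_widen (kn := kn) (@super_gradient_notin n x) xf.
move=> /(@veronese_free_top _ (Ordinal kk)) H.
rewrite web_mxE; apply/unit_mono_mx.
have -> : (fun b => gradient (fint E k.+1 b) (Defs.proj I x)) =
  (fun b l => super_gradient x
    (widen_super kn (super_at (full_indices (Ordinal kk)) b)) (widen_ord kn l)).
  apply/funext => b; apply/funext => l.
  have <- : tnth I l = widen_ord kn l by rewrite tnth_map tnth_ord_tuple.
  exact/esym/(@super_gradient_tnth _ _ (Ordinal kk) (exist _ I Is)).
apply: H => // s l ls; apply: super_gradient_notin.
apply/mapP => -[l' l's /(congr1 val) /= ll].
by rewrite (val_inj ll) l's in ls.
Qed.
End Superposition.
End Webs.

Theorem theorem1 (R : realType) (k0 : nat) (hk0 : (2 <= k0)%N)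
    (E : web_family R k0) (hE : balanced E) :
  [<-> forall n : nat, (2 <= n)%N ->
         ordinary (super_dom E n) (super_web E n hk0);
       ordinary (super_dom E k0) (super_web E k0 hk0);
       generically_invertible (super_dom E k0)
         (web_mx (super_web E k0 hk0) k0);
       forall k : nat, (1 <= k <= k0)%N ->
         generically_invertible (dom E k) (web_mx (fint E k) (k0 - k))].
Proof.
tfae.
- by apply.
- by move=> [A [Ao AD DA AP]]; exists A; split=> // x /AP; exact: unit_super_web_ordinary.
(* One point of invertibility is enough: it gives a point where the determinant of each T_k is
   nonzero, and connectedness of [dom E k] does the rest. *)
- move=> [A [_ AD DA AP]] k kk; have [x Dx] := hE.2 k0 hk0.
  have [x' [Ax' _]] := DA x Dx setT filterT.
  have kk0 : (k <= k0)%N by case/andP: kk.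
  have [y Dy yd] := super_web_invertible_block hk0 kk kk0 (AD x' Ax')
    ((unit_super_web_mx E hk0 x').1 (AP x' Ax')).
  have [_ Dc [Do uh _ _] _] := hE.1 k kk.
  exact: (gholomorphic_identity Do Dc (gholomorphic_web_det Do uh) Dy yd).
(* The open set [A] is dense in [proj_dom]; invertibility places it inside [super_dom], which lies
   in [proj_dom], so it is dense there too. *)
- move=> Hdet n n2; have [A [Ao AD DA AP]] := generically_super hE n Hdet.
  exists A; split=> // [x Ax|x Dx|x /AP].
  + exact: (super_dom_veronese hk0 hE (AD x Ax) (AP x Ax)).
  + by apply: DA; exact: super_dom_proj_dom.
  + exact: ordinary_super_web (ltnW n2).
Qed.
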